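(* Let $q>1$ and let $m_1<m_2<\cdots$ be positive integers with $\frac{m_{k+1}}{m_k}\ge q$ for all $k\in\mathbb{N}$. Let $(a_{k,n})_{1\le k\le n}$ be a triangular array of real numbers, and put $$S_n^{\mathrm W}(x)=\sum_{k=1}^n a_{k,n}W_{m_k}(x),\quad 0\le x\le 1,\qquad A_n=\Big(\sum_{k=1}^n a_{k,n}^2\Big)^{1/2},\qquad d_n=\max_{1\le k\le n}|a_{k,n}|,$$ where $W_m$ denotes the $m$th Walsh function. Suppose $A_n\to\infty$ as $n\to\infty$, and moreover that, as $n\to\infty$, - if $q\ge 2$: $\sum_{k=1}^n a_{k,n}^4\to\kappa_4<\infty$ and $n\,d_n^5\to 0$; - if $1<q<2$: $\varepsilon>0$ is such that $n^{1+\varepsilon}d_n^3\to 0$. Put $\gamma=\frac1{10}$ if $q\ge 2$ and $\gamma=\min\{\frac{\varepsilon}{3},\frac13\}$ if $1<q<2$. Then there is a constant $C$, independent of $n$, such that for all $n$ (with $A_n>0$) $$d_{Kol}\Big(\frac{S_n^{\mathrm W}}{A_n},\,\mathcal N(0,1)\Big)\le \frac{C}{A_n^{2\gamma+1}}.$$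
   Context: Walsh functions: let $r_0(x)=1$ for $0\le x<\frac12$, $r_0(x)=-1$ for $\frac12\le x<1$, extended to $\mathbb{R}$ with period $1$, and let $r_n(x)=r_0(2^nx)$, $n\ge 0$, be the Rademacher functions. If $n=\sum_{i\ge 0}k_i2^i$ with $k_i\in\{0,1\}$ is the dyadic expansion of $n$ and $l_1,\dots,l_m$ are the indices $i$ with $k_i=1$, then $W_n(x)=\prod_{i=1}^m r_{l_i}(x)$. $S_n^{\mathrm W}$ is regarded as a random variable on $[0,1]$ with Lebesgue measure, and $d_{Kol}$ is the Kolmogorov distance, i.e. the supremum over $t\in\mathbb{R}$ of the absolute difference of the two distribution functions at $t$. *)

(* Defs.v *)
From HB Require Import structures.
From mathcomp Require Import all_boot all_order all_algebra.
From mathcomp Require Import all_classical all_reals all_analysis measurable_realfun.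

Set Implicit Arguments.
Unset Strict Implicit.
Unset Printing Implicit Defensive.

Import Order.TTheory GRing.Theory Num.Theory.
Import numFieldNormedType.Exports.

Local Open Scope classical_set_scope.
Local Open Scope ring_scope.

Section walsh.
Context {R : realType}.
Implicit Types (x : R) (n : nat).

(* [x - floor x] makes the function 1-periodic *)
Definition rademacher0 x : R :=
  if x - (Num.floor x)%:~R < 2^-1 then 1 else -1.

Definition rademacher n x : R := rademacher0 (2 ^+ n * x).

(* [odd (n %/ 2 ^ i)] is the binary digit k_i of n; it vanishes for i >= n,
   since n < 2 ^ n *)
Definition walsh n x : R := \prod_(i < n | odd (n %/ 2 ^ i)) rademacher i x.

Lemma measurable_rademacher0 : measurable_fun [set: R] rademacher0.
Proof.
apply: measurable_fun_ifT; [|exact: measurable_cst..].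
apply: measurable_fun_ltr; last exact: measurable_cst.
apply: measurable_funB; first exact: measurable_id.
apply: nondecreasing_measurable => // x y xy.
by rewrite ler_int; exact: Num.Theory.le_floor.
Qed.

Lemma measurable_walsh n : measurable_fun [set: R] (walsh n).
Proof.
rewrite /walsh; under eq_fun do rewrite -big_filter.
apply: (@measurable_prod _ _ R _ _ _ (fun i : 'I_n => rademacher i)) => i _.
apply: measurableT_comp.
  exact: measurable_rademacher0.
by apply: measurable_funM; [exact: measurable_cst|exact: measurable_id].
Qed.

End walsh.

(* Triangular arrays [a k n] and sequences [m k] are indexed from k = 1; the
   values at indices outside 1 <= k <= n are never used. *)
Section walsh_sums.
Context {R : realType}.
Implicit Types (a : nat -> nat -> R) (m : nat -> nat) (n : nat).

Definition array_norm a n : R := Num.sqrt (\sum_(1 <= k < n.+1) a k n ^+ 2).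

Definition array_max a n : R := \big[Num.max/0]_(1 <= k < n.+1) `|a k n|.

Definition walsh_sum a m n (x : R) : R :=
  \sum_(1 <= k < n.+1) a k n * walsh (m k) x.

Definition normalized_walsh_sum a m n (x : measurableTypeR R) : R :=
  walsh_sum a m n x / array_norm a n.

Lemma measurable_normalized_walsh_sum a m n :
  measurable_fun [set: measurableTypeR R] (normalized_walsh_sum a m n).
Proof.
apply: measurable_funM; last exact: measurable_cst.
apply: measurable_sum => k; apply: measurable_funM; first exact: measurable_cst.
exact: measurable_walsh.
Qed.

HB.instance Definition _ a m n := isMeasurableFun.Build _ _ _ _
  (normalized_walsh_sum a m n) (measurable_normalized_walsh_sum a m n).

End walsh_sums.

Section lebesgue01.
Context (R : realType).

Definition lebesgue01 : set (measurableTypeR R) -> \bar R :=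
  mrestr (@lebesgue_measure R) (measurable_itv `[0, 1]).

HB.instance Definition _ := Measure.on lebesgue01.

Let lebesgue01_setT : lebesgue01 [set: _] = 1%E.
Proof.
by rewrite /lebesgue01 /mrestr setTI lebesgue_measure_itv/= lte_fin ltr01 oppr0
  adde0.
Qed.

HB.instance Definition _ :=
  @Measure_isProbability.Build _ _ R lebesgue01 lebesgue01_setT.

End lebesgue01.
Arguments lebesgue01 R _ : clear implicits.

Definition kolmogorov_dist d (T : measurableType d) (R : realType)
    (P : probability T R) (X : {RV P >-> R})
    (nu : probability (measurableTypeR R) R) : \bar R :=
  ereal_sup (range (fun t : R => `| cdf X t - nu `]-oo, t]%classic |%E)).

Definition rate_gamma {R : realType} (q eps : R) : R :=
  if 2 <= q then 10^-1 else Num.min (eps / 3) 3^-1.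

(* Main.v *)
Require Import Defs.
From HB Require Import structures.
From mathcomp Require Import all_boot all_order all_algebra.
From mathcomp Require Import all_classical all_reals all_analysis.
From mathcomp Require Import ring lra zify.

Set Implicit Arguments.
Unset Strict Implicit.
Unset Printing Implicit Defensive.

Import Order.TTheory GRing.Theory Num.Theory.
Import numFieldNormedType.Exports.

Local Open Scope classical_set_scope.
Local Open Scope ring_scope.

(** The Walsh function W_m with leading binary digit 2^j is r_j times a product
of Rademacher functions of index below j.  Grouping the terms of S_n by the
leading digit of m_k therefore writes S_n / A_n as a sum of r_j b_j, where b_j
depends on r_0, ..., r_(j-1) only: a martingale for the dyadic filtration, with
increments symmetric given the past.  A gap condition m_(k+1) >= q m_k bounds
the number of m_k that share a leading digit, so that |b_j| is at most a
constant times beta = d_n / A_n.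

The distance to the normal law is bounded by running the heat flow backwards.
Let Phi be the normal distribution function and V_j the sum of b_i^2 over
i < j.  The quantity Phi ((t - S_j) / sqrt (delta^2 + 1 - V_j)) starts at almost
Phi t and ends, up to V - 1 where V is the final value of V_j, at the smoothed
indicator Phi ((t - S) / delta).  One step replaces a Gaussian variable by a
sign of the same variance; the first three moments agree, so the error is
b_j^4 / v^2 with v = delta^2 + 1 - V_(j+1) the remaining variance
([gauss_cdf_heat_step]).  Since b_j^4 <= beta^2 b_j^2, these errors sum like
beta^2 times the integral of v^-2, that is to beta^2 / delta^2 and not to
beta^2 / delta^4.  As V_j is random, v is truncated below at delta^2, and a
potential function makes the errors telescope ([clip_heat_step]).  Undoing the
smoothing costs O(delta), because a Gaussian tail is dominated by the Gaussian
mass of a nearby interval ([indicator_gauss_cdf]).  The outcome,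
[dyadic_martingale_kolmogorov], is the bound
C (delta + beta^2 / delta^2 + E |V - 1| / delta^2) for beta <= delta <= 1.

If q >= 2, the leading digits are distinct, hence V = 1, and
delta = beta^(2/3) gives the distance O(beta^(2/3)).  If q < 2, then V - 1 is a
sum over j of products of two Walsh functions with the same leading digit; two
such indices already differ at one of the K digits that follow, so contributions
of levels more than K apart are orthogonal, E (V - 1)^2 = O(beta^2), and
delta = beta^(1/3) gives the distance O(beta^(1/3)).

It remains to express beta in A_n.  For q >= 2 the Cauchy-Schwarz inequality
A_n^4 <= n sum a^4 and n d_n^5 = O(1) give beta^5 = O(A_n^-9), thus
beta^(2/3) = O(A_n^(-6/5)).  For q < 2 the trivial bound A_n^2 <= n d_n^2 and
n^(1+eps) d_n^3 = O(1) give beta^(1/3) = O(A_n^-(2 gamma + 1)) as soon as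
3 gamma <= eps. *)

(** * The standard normal distribution function *)

Section gauss.
Context {R : realType}.
Implicit Types x y z s t w : R.

Definition gauss_pdf : R -> R := normal_pdf 0 1.

Definition gauss_cdf t : R := fine (normal_prob (0 : R) 1 `]-oo, t]).

Lemma gauss_pdfE z : gauss_pdf z = normal_peak 1 * expR (- (z ^+ 2 / 2)).
Proof.
rewrite /gauss_pdf normal_pdfE ?oner_eq0// /normal_fun subr0 expr1n.
by rewrite mulNr.
Qed.

Lemma normal_peak1_le1 : normal_peak (1 : R) <= 1.
Proof.
have pi2 := @pi_ge2 R.
rewrite /normal_peak expr1n mul1r invf_le1; last by rewrite sqrtr_gt0; lra.
by rewrite -[leLHS]sqrtr1 ler_sqrt; lra.
Qed.

Lemma gauss_pdf_gt0 z : 0 < gauss_pdf z.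
Proof. by rewrite gauss_pdfE mulr_gt0 ?expR_gt0 ?normal_peak_gt0 ?oner_eq0. Qed.

Lemma gauss_pdf_ge0 z : 0 <= gauss_pdf z.
Proof. exact/ltW/gauss_pdf_gt0. Qed.

Lemma le_gauss_pdf w z : `|w| <= `|z| -> gauss_pdf z <= gauss_pdf w.
Proof.
move=> wz; rewrite !gauss_pdfE ler_wpM2l ?normal_peak_ge0// ler_expR lerN2.
rewrite ler_wpM2r// -(real_normK (num_real w)) -(real_normK (num_real z)).
by rewrite lerXn2r ?nnegrE.
Qed.

(** The square of exp (z^2 / 4) >= 1 + z^2 / 4 beats the factor in front of the
density; all bounds on a polynomial of degree at most 4 times the density follow
from this one. *)
Lemma gauss_pdf_quartic z : (16 + 8 * z ^+ 2 + z ^+ 4) * gauss_pdf z <= 16.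
Proof.
pose h := expR (z ^+ 2 / 4).
have h1 : 1 + z ^+ 2 / 4 <= h by exact: expR_ge1Dx.
have h0 : 0 < h by exact: expR_gt0.
have -> : gauss_pdf z = normal_peak 1 / (h ^+ 2).
  by rewrite gauss_pdfE /h -expRM_natl -expRN; congr (_ * expR _); field.
have k1 := normal_peak1_le1.
have k0 := normal_peak_ge0 (1 : R).
rewrite mulrA ler_pdivrMr ?exprn_gt0//.
have -> : 16 + 8 * z ^+ 2 + z ^+ 4 = 16 * (1 + z ^+ 2 / 4) ^+ 2 by field.
rewrite -mulrA ler_pM2l//.
have z0 : 0 <= z ^+ 2 / 4 by rewrite divr_ge0 ?sqr_ge0.
apply: (@le_trans _ _ ((1 + z ^+ 2 / 4) ^+ 2)).
  by rewrite ler_piMr// sqr_ge0.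
by rewrite lerXn2r ?nnegrE// ?ltW//; lra.
Qed.

Lemma gauss_pdf_le1 z : gauss_pdf z <= 1.
Proof.
have := gauss_pdf_quartic z; have := gauss_pdf_ge0 z.
have := sqr_ge0 z; have : 0 <= z ^+ 4 by rewrite exprn_even_ge0.
by nra.
Qed.

Lemma is_derive_gauss_cdf z : is_derive z 1 gauss_cdf (gauss_pdf z).
Proof.
have [||||d1 d2] := @continuous_FTC1 R gauss_pdf (BInfty _ true) z (z + 1).
- by rewrite ltrDl.
- apply: (@integrableS _ _ _ _ setT) => //.
  exact: integrable_normal_pdf.
- by rewrite /= ltNyr.
- by apply: continuous_normal_pdf; rewrite oner_eq0.
by apply: DeriveDef; [exact: d1|rewrite -derive1E; exact: d2].
Qed.

Lemma is_derive_gauss_pdf z : is_derive z 1 gauss_pdf (- z * gauss_pdf z).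
Proof.
have -> : gauss_pdf = fun z => normal_peak 1 * expR (- (z ^+ 2 / 2)).
  by apply/funext => y; rewrite gauss_pdfE.
apply: is_derive_eq.
by rewrite /GRing.scale/=; field.
Qed.

End gauss.

(** * Mean value and Taylor estimates *)

Section taylor.
Context {R : realType}.
Implicit Types (f df : R -> R) (x z s a b c B : R).

(** The end points may come in either order, which spares the later estimates a
case distinction on the sign of the increment. *)
Lemma mvt f df (hf : forall x, is_derive x 1 f (df x)) a b :
  exists2 c, (a <= c <= b) || (b <= c <= a) & f b - f a = df c * (b - a).
Proof.
have cf u v : {within `[u, v], continuous f}.
  apply: continuous_subspaceT => x.
  by apply/differentiable_continuous/derivable1_diffP; have [] := hf x.
have [ab|/ltW ba] := leP a b.
  have [c + ->] := @MVT_segment _ f df a b ab (fun x _ => hf x) (cf a b).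
  by rewrite in_itv/= => abc; exists c => //; rewrite abc.
have [c + e] := @MVT_segment _ f df b a ba (fun x _ => hf x) (cf b a).
rewrite in_itv/= => abc; exists c; first by rewrite abc orbT.
by rewrite -opprB e -mulrN opprB.
Qed.

(** Integration of a power bound; the gain of a factor 1 / (k + 1) is given up for
a statement that iterates without bookkeeping. *)
Lemma le_pow_from_derive f df B k (hf : forall x, is_derive x 1 f (df x)) :
  0 <= B -> f 0 = 0 -> (forall s, 0 <= s -> `|df s| <= B * s ^+ k) ->
  forall s, 0 <= s -> `|f s| <= B * s ^+ k.+1.
Proof.
move=> B0 f0 hdf s s0.
have [c + e] := mvt hf 0 s; rewrite f0 !subr0 in e.
move=> /orP[/andP[c0 cs]|/andP[sc c0]]; last first.
  have -> : s = 0 by apply: le_anti; rewrite s0 (le_trans sc).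
  by rewrite f0 normr0 mulr_ge0// exprn_ge0.
rewrite e normrM (ger0_norm s0) exprSr mulrA ler_wpM2r//.
by rewrite (le_trans (hdf _ c0))// ler_wpM2l// lerXn2r.
Qed.

Lemma is_derive_shift f df z (hf : forall x, is_derive x 1 f (df x)) s :
  is_derive s 1 (fun s => f (z + s)) (df (z + s)).
Proof.
have h : is_derive s 1 (fun s => z + s) 1.
  by apply: is_derive_eq; ring.
have := @is_derive1_comp _ f (fun s => z + s) s _ _ (hf _) h.
by rewrite mulr1.
Qed.

Lemma is_derive_reflect f df z (hf : forall x, is_derive x 1 f (df x)) s :
  is_derive s 1 (fun s => f (z - s)) (- df (z - s)).
Proof.
have h : is_derive s 1 (fun s => z - s) (-1).
  by apply: is_derive_eq; ring.
have := @is_derive1_comp _ f (fun s => z - s) s _ _ (hf _) h.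
by rewrite mulrN1.
Qed.

(** The terms of odd order cancel in a symmetric second difference, so the
remainder is of order 4.  The bound on the fourth derivative is integrated four
times; at each stage the symmetric (or antisymmetric) part vanishes at 0. *)
Lemma symmetric_taylor f f1 f2 f3 f4 B z
  (h1 : forall x, is_derive x 1 f (f1 x))
  (h2 : forall x, is_derive x 1 f1 (f2 x))
  (h3 : forall x, is_derive x 1 f2 (f3 x))
  (h4 : forall x, is_derive x 1 f3 (f4 x))
  (hB : forall x, `|f4 x| <= B) s : 0 <= s ->
  `|2^-1 * (f (z + s) + f (z - s)) - f z - 2^-1 * s ^+ 2 * f2 z|
    <= B * s ^+ 4.
Proof.
have B0 : 0 <= B by rewrite (le_trans _ (hB 0)).
have sh g g' (hg : forall x, is_derive x 1 g (g' x)) := is_derive_shift z hg.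
have re g g' (hg : forall x, is_derive x 1 g (g' x)) := is_derive_reflect z hg.
pose g3 s := 2^-1 * (f3 (z + s) - f3 (z - s)).
pose g2 s := 2^-1 * (f2 (z + s) + f2 (z - s)) - f2 z.
pose g1 s := 2^-1 * (f1 (z + s) - f1 (z - s)) - s * f2 z.
pose g0 s := 2^-1 * (f (z + s) + f (z - s)) - f z - 2^-1 * s ^+ 2 * f2 z.
have d4 x : is_derive x 1 g3 (2^-1 * (f4 (z + x) + f4 (z - x))).
  have ? := sh _ _ h4 x; have ? := re _ _ h4 x.
  by apply: is_derive_eq; rewrite /GRing.scale/=; ring.
have d3 x : is_derive x 1 g2 (g3 x).
  have ? := sh _ _ h3 x; have ? := re _ _ h3 x.
  by apply: is_derive_eq; rewrite /GRing.scale/= /g3; ring.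
have d2 x : is_derive x 1 g1 (g2 x).
  have ? := sh _ _ h2 x; have ? := re _ _ h2 x.
  by apply: is_derive_eq; rewrite /GRing.scale/= /g2; ring.
have d1 x : is_derive x 1 g0 (g1 x).
  have ? := sh _ _ h1 x; have ? := re _ _ h1 x.
  by apply: is_derive_eq; rewrite /GRing.scale/= /g1; field.
move: s; apply: (le_pow_from_derive d1) => //.
  by rewrite /g0 addr0 subr0 expr0n/=; field.
apply: (le_pow_from_derive d2) => //.
  by rewrite /g1 addr0 subr0; ring.
apply: (le_pow_from_derive d3) => //.
  by rewrite /g2 addr0 subr0; field.
apply: (@le_pow_from_derive _ _ _ 0 d4) => //.
  by rewrite /g3 addr0 subr0; ring.
move=> s _; rewrite expr0 mulr1.
have := hB (z + s); have := hB (z - s); rewrite !ler_norml.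
by move=> /andP[? ?] /andP[? ?]; apply/andP; split; lra.
Qed.

End taylor.

(** * One step of the heat flow *)

Section gauss_estimates.
Context {R : realType}.
Implicit Types (x z w s t y v b : R).
Notation phi := (@gauss_pdf R).
Notation Phi := (@gauss_cdf R).

Lemma is_derive_gauss_pdf2 z :
  is_derive z 1 (fun z => - z * phi z) ((z ^+ 2 - 1) * phi z).
Proof.
have ? := is_derive_gauss_pdf z.
by apply: is_derive_eq; rewrite /GRing.scale/=; ring.
Qed.

Lemma is_derive_gauss_pdf3 z :
  is_derive z 1 (fun z => (z ^+ 2 - 1) * phi z) ((3 * z - z ^+ 3) * phi z).
Proof.
have ? := is_derive_gauss_pdf z.
by apply: is_derive_eq; rewrite /GRing.scale/=; ring.
Qed.

Lemma le_quartic_gauss_pdf z (p : R) :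
  p <= 16 + 8 * z ^+ 2 + z ^+ 4 -> p * phi z <= 16.
Proof.
move=> hp; apply: le_trans (gauss_pdf_quartic z).
by rewrite ler_wpM2r// gauss_pdf_ge0.
Qed.

Lemma gauss_pdf4_bound z : `|(3 * z - z ^+ 3) * phi z| <= 16.
Proof.
rewrite normrM (ger0_norm (gauss_pdf_ge0 z)); apply: le_quartic_gauss_pdf.
rewrite ler_norml; apply/andP; split; nra.
Qed.

Lemma normr_gauss_pdf_bound z : `|z| * phi z <= 16.
Proof.
apply: le_quartic_gauss_pdf; rewrite ler_norml; apply/andP; split; nra.
Qed.

Lemma normr3_gauss_pdf_bound z : `|z| ^+ 3 * phi z <= 16.
Proof.
apply: le_quartic_gauss_pdf; rewrite -normrX ler_norml.
by apply/andP; split; nra.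
Qed.

Lemma gauss_cdf_ge0 t : 0 <= Phi t.
Proof. by rewrite /gauss_cdf fine_ge0. Qed.

Lemma gauss_cdf_le1 t : Phi t <= 1.
Proof.
rewrite /gauss_cdf -lee_fin fineK ?fin_num_measure//.
exact: probability_le1.
Qed.

Lemma le_gauss_cdf x y : x <= y -> Phi x <= Phi y.
Proof.
move=> xy; have [c _] := mvt is_derive_gauss_cdf x y.
move=> e; rewrite -subr_ge0 e mulr_ge0 ?gauss_pdf_ge0 ?subr_ge0//.
Qed.

Lemma gauss_cdf_lip x y : `|Phi y - Phi x| <= `|y - x|.
Proof.
have [c _ ->] := mvt is_derive_gauss_cdf x y.
by rewrite normrM ler_piMl// (ger0_norm (gauss_pdf_ge0 _)) gauss_pdf_le1.
Qed.

(** Both end points have the same sign, so a point between them also has its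
absolute value between theirs. *)
Lemma norm_between w (r c : R) : 1 <= r ->
  (w <= c <= r * w) || (r * w <= c <= w) -> `|w| <= `|c| <= `|r * w|.
Proof.
move=> r1 h; have [w0|w0] := leP 0 w.
  have rw : w <= r * w by nra.
  have [wc cz] : w <= c /\ c <= r * w.
    by case/orP: h => /andP[? ?]; split=> //; lra.
  by rewrite !ger0_norm ?wc ?cz//; lra.
have rw : r * w <= w by nra.
have [wc cz] : c <= w /\ r * w <= c.
  by case/orP: h => /andP[? ?]; split=> //; lra.
by rewrite !ler0_norm ?lerN2 ?wc ?cz//; lra.
Qed.

(** The density on the segment from w to r w is largest at w, the end point
closest to 0, and |w| times the density at w is bounded. *)
Lemma gauss_cdf_dilate w s (r : R) : 1 <= r -> r ^+ 2 = 1 + s ^+ 2 ->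
  `|Phi w - Phi (r * w)| <= 16 * s ^+ 2.
Proof.
move=> r1 rs; rewrite distrC.
have [c /(norm_between r1)/andP[wc _] ->] := mvt is_derive_gauss_cdf w (r * w).
have s2 := sqr_ge0 s.
have -> : r * w - w = (r - 1) * w by ring.
rewrite !normrM (ger0_norm (gauss_pdf_ge0 _)) (ger0_norm (_ : 0 <= r - 1)); last lra.
have h := normr_gauss_pdf_bound w.
have h1 := le_gauss_pdf wc.
have h2 : r - 1 <= s ^+ 2 by nra.
have w0 := normr_ge0 w.
have h3 : 0 <= r - 1 by lra.
rewrite mulrCA mulrC ler_pM// ?mulr_ge0// ?gauss_pdf_ge0//.
by apply: le_trans h; rewrite mulrC ler_wpM2l.
Qed.

(** Second-order expansion of the distribution function at z = r w.  As
r - 1 = s^2 / 2 + O(s^4), the linear term equals half of s^2 times the second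
derivative - z phi(z), up to O(s^4), and the quadratic term is O(s^4) too. *)
Lemma gauss_cdf_dilate2 w s (r : R) : 1 <= r -> r ^+ 2 = 1 + s ^+ 2 -> s ^+ 2 <= 1 ->
  `|Phi w - Phi (r * w) - 2^-1 * s ^+ 2 * (- (r * w) * phi (r * w))|
    <= 48 * s ^+ 4.
Proof.
move=> r1 rs s1; set z := r * w.
have s2 := sqr_ge0 s.
have s4 : s ^+ 4 = s ^+ 2 * s ^+ 2 by ring.
have r2 : r <= 2 by nra.
have h1 : r - 1 <= 2^-1 * s ^+ 2 by nra.
have [c hc e1] := mvt is_derive_gauss_cdf z w.
have [c' hc' e2] := mvt is_derive_gauss_pdf z c.
have /andP[wc cz] : `|w| <= `|c'| <= `|z|.
  apply: norm_between => //.
  move: hc hc'; rewrite -/z => /orP[|]/andP[? ?] /orP[|]/andP[? ?];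
  apply/orP; solve [left; apply/andP; split; lra | right; apply/andP; split; lra].
have czw : `|c - z| <= `|w - z|.
  case/orP: hc => /andP[? ?].
    by rewrite !ger0_norm; lra.
  by rewrite !ler0_norm; lra.
have wz : `|w - z| <= 2^-1 * s ^+ 2 * `|w|.
  have -> : w - z = (1 - r) * w by rewrite /z; ring.
  by rewrite normrM ler_wpM2r// distrC ger0_norm//; lra.
have zw : `|z| <= 2 * `|w|.
  by rewrite /z normrM ler_wpM2r// ger0_norm//; lra.
have -> : Phi w - Phi z - 2^-1 * s ^+ 2 * (- z * phi z) =
   (- c' * phi c' * (c - z)) * (w - z)
   + phi z * (w * ((r - 1) ^+ 2 * (2 + r) / 2)).
  rewrite e1 -e2.
  have -> : w * ((r - 1) ^+ 2 * (2 + r) / 2) = w - z + 2^-1 * s ^+ 2 * z.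
    have -> : s ^+ 2 = r ^+ 2 - 1 by rewrite rs; ring.
    by rewrite /z; field.
  by ring.
have -> : 48 * s ^+ 4 = 32 * s ^+ 4 + 16 * s ^+ 4 by ring.
apply: le_trans (ler_normD _ _) _; apply: lerD.
  rewrite !normrM normrN (ger0_norm (gauss_pdf_ge0 _)).
  apply: (@le_trans _ _ ((2 * `|w|) * phi w * (2^-1 * s ^+ 2 * `|w|)
      * (2^-1 * s ^+ 2 * `|w|))).
    apply: ler_pM => //; first by rewrite !mulr_ge0// gauss_pdf_ge0.
    apply: ler_pM => //; first by rewrite !mulr_ge0// gauss_pdf_ge0.
      apply: ler_pM => //; first exact: gauss_pdf_ge0.
        exact: le_trans zw.
      exact: le_gauss_pdf.
    exact: le_trans wz.
  have h := normr3_gauss_pdf_bound w.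
  have -> : 2 * `|w| * phi w * (2^-1 * s ^+ 2 * `|w|) * (2^-1 * s ^+ 2 * `|w|)
    = 2^-1 * s ^+ 4 * (`|w| ^+ 3 * phi w) by field.
  have : 0 <= s ^+ 4 by rewrite exprn_even_ge0.
  by nra.
rewrite !normrM (ger0_norm (gauss_pdf_ge0 _)) mulrCA mulrA.
have hz : `|w| * phi z <= 16.
  apply: le_trans (normr_gauss_pdf_bound w).
  by rewrite ler_wpM2l// le_gauss_pdf// /z normrM ler_peMl// ger0_norm//; lra.
apply: ler_pM => //; first by rewrite mulr_ge0// gauss_pdf_ge0.
rewrite -!normrM ger0_norm; last first.
  by rewrite divr_ge0// mulr_ge0 ?sqr_ge0//; lra.
have h4 : (r - 1) ^+ 2 <= 4^-1 * s ^+ 4 by rewrite s4; nra.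
have := sqr_ge0 (r - 1); nra.
Qed.

(** A random sign times s and a centred Gaussian variable of variance s^2 have
the same moments up to order 3; added to an independent standard Gaussian
variable they are distinguished by the distribution function only at order s^4.
The sum with the Gaussian variable has variance r^2 = 1 + s^2, whence the
argument w when the other sum is evaluated around r w. *)
Lemma gauss_cdf_heat_step w s (r : R) : 0 <= s <= 1 -> 1 <= r ->
  r ^+ 2 = 1 + s ^+ 2 ->
  `|2^-1 * (Phi (r * w + s) + Phi (r * w - s)) - Phi w| <= 64 * s ^+ 4.
Proof.
move=> /andP[s0 s1] r1 rs.
have h1 := symmetric_taylor (r * w) is_derive_gauss_cdf is_derive_gauss_pdf
  is_derive_gauss_pdf2 is_derive_gauss_pdf3 gauss_pdf4_bound s0.
have h2 := gauss_cdf_dilate2 w r1 rs (exprn_ile1 _ s0 s1).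
move: h1 h2; rewrite !ler_norml => /andP[? ?] /andP[? ?].
by apply/andP; split; lra.
Qed.

(** The probability that a centred Gaussian variable of variance v is at most x,
that is, the solution of the heat equation started from a step function. *)
Definition heat x v : R := Phi (x / Num.sqrt v).

(** [gauss_cdf_heat_step] after rescaling by the square root of v. *)
Lemma heat_step x v b : 0 < v -> b ^+ 2 <= v ->
  `|2^-1 * (heat (x + b) v + heat (x - b) v) - heat x (v + b ^+ 2)|
    <= 64 * (b ^+ 4 / v ^+ 2).
Proof.
move=> v0 bv; wlog b0 : b bv / 0 <= b.
  move=> H; have [b0|/ltW b0] := leP 0 b; first exact: H.
  have := H (- b); rewrite !sqrrN opprK (addrC (heat (x - b) v)).
  rewrite (_ : (- b) ^+ 4 = b ^+ 4); last by ring.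
  by apply=> //; rewrite oppr_ge0.
set q := Num.sqrt v; have q0 : 0 < q by rewrite sqrtr_gt0.
have qv : q ^+ 2 = v by rewrite sqr_sqrtr// ltW.
set q' := Num.sqrt (v + b ^+ 2).
have v'0 : 0 < v + b ^+ 2 by rewrite ltr_wpDr// sqr_ge0.
have q'0 : 0 < q' by rewrite sqrtr_gt0.
have q'v : q' ^+ 2 = v + b ^+ 2 by rewrite sqr_sqrtr// ltW.
have bq : b <= q by rewrite -(@ler_pXn2r _ 2) ?nnegrE ?(ltW q0)// qv.
have qq' : q <= q'.
  rewrite -(@ler_pXn2r _ 2) ?nnegrE ?(ltW q0) ?(ltW q'0)//.
  by rewrite qv q'v lerDl sqr_ge0.
have := @gauss_cdf_heat_step (x / q') (b / q) (q' / q).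
have -> : q' / q * (x / q') = x / q by field; rewrite !gt_eqF.
rewrite -mulrDl -mulrBl /heat -/q -/q'.
have -> : (b / q) ^+ 4 = b ^+ 4 / v ^+ 2 by rewrite -qv; field; rewrite gt_eqF.
apply; first by rewrite divr_ge0 ?(ltW q0)//= ler_pdivrMr// mul1r.
  by rewrite ler_pdivlMr// mul1r.
by rewrite !expr_div_n q'v qv; field; rewrite gt_eqF.
Qed.

(** [gauss_cdf_dilate] after rescaling by the square root of v. *)
Lemma heat_time x v v' : 0 < v -> v <= v' ->
  `|heat x v' - heat x v| <= 16 * ((v' - v) / v).
Proof.
move=> v0 vv'; have v'0 := lt_le_trans v0 vv'.
set q := Num.sqrt v; have q0 : 0 < q by rewrite sqrtr_gt0.
have qv : q ^+ 2 = v by rewrite sqr_sqrtr// ltW.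
set q' := Num.sqrt v'; have q'0 : 0 < q' by rewrite sqrtr_gt0.
have q'v : q' ^+ 2 = v' by rewrite sqr_sqrtr// ltW.
have qq' : q <= q' by rewrite -(@ler_pXn2r _ 2) ?nnegrE ?(ltW q0) ?(ltW q'0)// qv q'v.
have d0 : 0 <= (v' - v) / v by rewrite divr_ge0 ?subr_ge0// ltW.
have := @gauss_cdf_dilate (x / q') (Num.sqrt ((v' - v) / v)) (q' / q).
have -> : q' / q * (x / q') = x / q by field; rewrite !gt_eqF.
rewrite sqr_sqrtr// /heat; apply.
  by rewrite ler_pdivlMr// mul1r.
by rewrite expr_div_n q'v qv; field; rewrite gt_eqF.
Qed.

End gauss_estimates.

(** * Gaussian tails *)

Section gauss_tail.
Context {R : realType}.
Implicit Types (x y e : R).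
Notation phi := (@gauss_pdf R).
Notation Phi := (@gauss_cdf R).

Lemma gauss_cdfE y :
  (Phi y)%:E = normal_prob (0 : R) 1 `]-oo, y].
Proof. by rewrite /gauss_cdf fineK// fin_num_measure. Qed.

Let idTR : measurableTypeR R -> R := idfun.

#[local] HB.instance Definition _ :=
  @isMeasurableFun.Build _ _ _ _ idTR (@measurable_id _ _ setT).

Let gauss_cdf_cdf y :
  Phi y = fine (cdf (idTR : {RV normal_prob (0 : R) 1 >-> R}) y).
Proof. by rewrite /= preimage_id. Qed.

Lemma gauss_cdf_pinfty e : 0 < e -> exists Y, forall y, Y <= y -> 1 - Phi y < e.
Proof.
move=> e0; have := cvg_cdfy1 (idTR : {RV normal_prob (0 : R) 1 >-> R}).
move=> /fine_cvgP[_] /cvgrPdist_lt /(_ e e0).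
case=> Y [Yr hY]; exists (Y + 1) => y Yy; rewrite gauss_cdf_cdf.
by apply: ltr_normlW; apply: hY; lra.
Qed.

Lemma gauss_cdf_ninfty e : 0 < e -> exists Y, forall y, y <= Y -> Phi y < e.
Proof.
move=> e0; have := cvg_cdfNy0 (idTR : {RV normal_prob (0 : R) 1 >-> R}).
move=> /fine_cvgP[_] /cvgr0Pnorm_lt /(_ e e0).
case=> Y [Yr hY]; exists (Y - 1) => y Yy; rewrite gauss_cdf_cdf.
by apply: ltr_normlW; apply: hY; lra.
Qed.

(** The sum of the two values has derivative 0, and tends to 1 at infinity. *)
Lemma gauss_cdfN y : Phi (- y) = 1 - Phi y.
Proof.
have d x : is_derive x 1 (fun x => Phi (0 + x) + Phi (0 - x)) 0.
  have ? := is_derive_shift 0 is_derive_gauss_cdf x.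
  have ? := is_derive_reflect 0 is_derive_gauss_cdf x.
  apply: is_derive_eq; apply/eqP; rewrite subr_eq0 !gauss_pdfE; apply/eqP.
  by congr (_ * expR (- (_ / 2))); ring.
have cst x : Phi x + Phi (- x) = Phi y + Phi (- y).
  have [c _ /eqP] := mvt d y x.
  by rewrite !add0r mul0r subr_eq0 => /eqP.
apply/eqP; rewrite -subr_eq0 -normr_le0; apply/ler_addgt0Pl => e e0.
have e20 : 0 < e / 2 by rewrite divr_gt0.
have [Y hY] := gauss_cdf_pinfty e20.
have [Z hZ] := gauss_cdf_ninfty e20.
pose x := `|Y| + `|Z|.
have h1 := hY x; have h2 := hZ (- x).
have : Phi x + Phi (- x) = Phi y + Phi (- y) by [].
have := h1 _; have := h2 _.
have := ler_norm Y; have := ler_norm (- Z); have := normr_ge0 Y.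
have := normr_ge0 Z; rewrite normrN /x => ? ? ? ? h3 h4.
have {}h3 := h3 (ltac:(lra)); have {}h4 := h4 (ltac:(lra)).
have := gauss_cdf_le1 (`|Y| + `|Z|); have := gauss_cdf_ge0 (- (`|Y| + `|Z|)).
by move=> ? ? ?; rewrite addr0 ler_norml; apply/andP; split; lra.
Qed.

Definition tail_const : R := 2 + (phi 1)^-1.

Lemma tail_const_ge2 : 2 <= tail_const.
Proof. by rewrite lerDl invr_ge0 gauss_pdf_ge0. Qed.

(** For y <= 1 the interval [y - 1, y] lies in [-1, 1], where the density is at
least phi(1).  For y >= 1 the difference of the two sides decreases, because
phi(y - 1) >= (3/2) phi(y) and the constant is at least 2; its limit at infinity
is nonnegative. *)
Lemma gauss_tail y : 0 <= y -> 1 - Phi y <= tail_const * (Phi y - Phi (y - 1)).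
Proof.
move=> y0; have K2 := tail_const_ge2; have p0 := gauss_pdf_gt0 (1 : R).
have Kp : 1 <= tail_const * phi 1.
  by rewrite mulrDl mulVf ?gt_eqF// lerDr mulr_ge0 ?ltW.
have [y1|y1] := leP y 1.
  have [c hc e] := mvt is_derive_gauss_cdf (y - 1) y.
  have c1 : `|c| <= `|1 : R|.
    rewrite normr1 ler_norml.
    by case/orP: hc => /andP[? ?]; apply/andP; split; lra.
  have := le_gauss_pdf c1; have := gauss_cdf_ge0 y.
  by rewrite e; nra.
pose H x := tail_const * (Phi (0 + x) - Phi (- 1 + x)) - (1 - Phi (0 + x)).
have d x : is_derive x 1 H (tail_const * (phi (0 + x) - phi (- 1 + x)) + phi (0 + x)).
  have ? := is_derive_shift 0 is_derive_gauss_cdf x.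
  have ? := is_derive_shift (-1) is_derive_gauss_cdf x.
  by apply: is_derive_eq; rewrite /GRing.scale/=; ring.
have H_dec x : y <= x -> H x <= H y.
  move=> yx; have [c hc e] := mvt d y x.
  rewrite -subr_le0 e mulr_le0_ge0 ?subr_ge0// add0r.
  have c1 : 1 <= c by case/orP: hc => /andP[? ?]; lra.
  have : 3 / 2 * phi c <= phi (-1 + c).
    rewrite !gauss_pdfE mulrCA ler_wpM2l ?normal_peak_ge0//.
    rewrite (_ : - ((-1 + c) ^+ 2 / 2) = (c - 2^-1) + - (c ^+ 2 / 2)); last by field.
    rewrite expRD ler_wpM2r ?expR_ge0//.
    by apply: le_trans (expR_ge1Dx _); lra.
  by have := gauss_pdf_ge0 c; nra.
rewrite -subr_ge0; have -> : tail_const * (Phi y - Phi (y - 1)) - (1 - Phi y) = H y.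
  by rewrite /H add0r (addrC (-1)).
apply/ler_addgt0Pr => e e0; have [Y hY] := gauss_cdf_pinfty e0.
have yx : y <= y + `|Y| by rewrite lerDl.
have Yx : Y <= y + `|Y| by have := ler_norm Y; lra.
have := H_dec _ yx; have := hY _ Yx.
have : 0 <= tail_const * (Phi (0 + (y + `|Y|)) - Phi (- 1 + (y + `|Y|))).
  by rewrite mulr_ge0 ?subr_ge0 ?le_gauss_cdf//; lra.
by rewrite {1}/H (add0r (y + `|Y|)); lra.
Qed.

(** The error made in replacing a step function by Phi is dominated by a
difference of values of Phi.  Applied to y = (t - S) / delta and averaged, it
controls the distribution function of S by the smoothed one alone, without any a
priori information on the concentration of S. *)
Lemma indicator_gauss_cdf y :
  `|(0 <= y)%R%:R - Phi y| <= tail_const * (Phi (y + 1) - Phi (y - 1)).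
Proof.
have K2 := tail_const_ge2.
have K0 : 0 <= tail_const by lra.
have [y0|y0] := leP 0 y; rewrite /=.
  have := gauss_cdf_le1 y => ?; rewrite ger0_norm ?subr_ge0//.
  apply: (le_trans (gauss_tail y0)).
  have : Phi y <= Phi (y + 1) by apply: le_gauss_cdf; lra.
  by move=> ?; rewrite ler_wpM2l//; lra.
have := gauss_cdf_ge0 y => ?; rewrite sub0r normrN ger0_norm//.
have := @gauss_tail (- y).
rewrite oppr_ge0 (ltW y0) gauss_cdfN subKr -opprD gauss_cdfN.
move=> /(_ isT) h; apply: (le_trans h); rewrite ler_wpM2l//.
have : Phi (y - 1) <= Phi y by apply: le_gauss_cdf; lra.
by lra.
Qed.

End gauss_tail.

(** * Heat flow with truncated variance *)

Section clipped_heat.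
Context {R : realType}.
Implicit Types (x w b beta delta : R).

(** The variance w left to the Gaussian part can become negative when the
conditional variances of the martingale are random; delta ^+ 2 is then the only
smoothing. *)
Definition clip_heat delta x w : R := heat x (delta ^+ 2 + Num.max w 0).

(** An upper bound, up to a constant, for the total error committed until the
variance w is left.  The first term pays for the steps with w >= 0, since its
increment is of order beta^2 b^2 / v^2; the second for the steps with w < 0, each
of which costs b^2 / delta^2; the third for the step where w changes sign. *)
Definition potential beta delta w : R :=
  beta ^+ 2 / (delta ^+ 2 + Num.max w 0) + Num.max (- w) 0 / delta ^+ 2
  + (if w < 0 then beta ^+ 2 / delta ^+ 2 else 0).

Lemma potential_ge0 beta delta w : 0 < delta -> 0 <= potential beta delta w.
Proof.
move=> d0; have d2 := sqr_ge0 delta; have b2 := sqr_ge0 beta.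
have m1 : 0 <= Num.max w 0 by rewrite le_max lexx orbT.
have m2 : 0 <= Num.max (- w) 0 by rewrite le_max lexx orbT.
rewrite /potential !addr_ge0 ?divr_ge0 ?addr_ge0//.
by case: ifP => // _; rewrite divr_ge0.
Qed.

Lemma le_potential beta delta w : 0 < delta ->
  potential beta delta w <= 2 * (beta ^+ 2 / delta ^+ 2) + `|w| / delta ^+ 2.
Proof.
move=> d0; have d2 : 0 < delta ^+ 2 by rewrite exprn_gt0.
have b2 := sqr_ge0 beta.
have m1 : 0 <= Num.max w 0 by rewrite le_max lexx orbT.
have h1 : beta ^+ 2 / (delta ^+ 2 + Num.max w 0) <= beta ^+ 2 / delta ^+ 2.
  rewrite ler_wpM2l// lef_pV2 ?posrE ?lerDl//.
  by rewrite ltr_wpDr.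
have h2 : Num.max (- w) 0 / delta ^+ 2 <= `|w| / delta ^+ 2.
  rewrite ler_wpM2r ?invr_ge0 ?(ltW d2)// ge_max normr_ge0 andbT.
  by rewrite -normrN ler_norm.
have h3 : (if w < 0 then beta ^+ 2 / delta ^+ 2 else 0) <= beta ^+ 2 / delta ^+ 2.
  by case: ifP => // _; rewrite divr_ge0 ?(ltW d2).
by rewrite /potential; lra.
Qed.

(** As long as w - b^2 >= 0 this is the fourth-order estimate of [heat_step];
afterwards the variance no longer compensates the step, whose cost is only of
second order. *)
Lemma clip_heat_step beta delta x w b : 0 < delta -> beta <= delta ->
  `|b| <= beta ->
  `|2^-1 * (clip_heat delta (x + b) (w - b ^+ 2) +
            clip_heat delta (x - b) (w - b ^+ 2)) - clip_heat delta x w|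
  <= 128 * (potential beta delta (w - b ^+ 2) - potential beta delta w).
Proof.
move=> d0 bd bb; have d2 : 0 < delta ^+ 2 by rewrite exprn_gt0.
have beta0 : 0 <= beta by rewrite (le_trans _ bb).
have b2 : 0 <= b ^+ 2 by exact: sqr_ge0.
have b2b : b ^+ 2 <= beta ^+ 2.
  by rewrite -(real_normK (num_real b)) lerXn2r ?nnegrE.
have b2d : beta ^+ 2 <= delta ^+ 2 by rewrite lerXn2r ?nnegrE// (ltW d0).
(* the variance left after the step is still nonnegative *)
have [w'0|w'0] := leP 0 (w - b ^+ 2).
  have w0 : 0 <= w by lra.
  rewrite /clip_heat /potential.
  rewrite (max_l w'0) (max_l w0) (max_r (_ : - w <= 0)) ?oppr_le0//.
  rewrite (max_r (_ : - (w - b ^+ 2) <= 0)) ?oppr_le0//.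
  rewrite !ltNge w'0 w0 /= mul0r !addr0.
  set v := delta ^+ 2 + (w - b ^+ 2).
  have -> : delta ^+ 2 + w = v + b ^+ 2 by rewrite /v; ring.
  have v0 : 0 < v by rewrite ltr_wpDr.
  have bv : b ^+ 2 <= v by rewrite /v; lra.
  apply: le_trans (heat_step x v0 bv) _.
  have -> : beta ^+ 2 / v - beta ^+ 2 / (v + b ^+ 2) =
            beta ^+ 2 * b ^+ 2 / (v * (v + b ^+ 2)).
    by field; rewrite !gt_eqF// ltr_wpDr.
  have -> : b ^+ 4 / v ^+ 2 = (b ^+ 2 * b ^+ 2 * (v + b ^+ 2)) / (v ^+ 2 * (v + b ^+ 2)).
    by field; rewrite !gt_eqF// ltr_wpDr.
  have -> : beta ^+ 2 * b ^+ 2 / (v * (v + b ^+ 2)) =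
      beta ^+ 2 * b ^+ 2 * v / (v ^+ 2 * (v + b ^+ 2)).
    by field; rewrite !gt_eqF// ltr_wpDr.
  rewrite !mulrA ler_wpM2r//.
    by rewrite invr_ge0 mulr_ge0 ?sqr_ge0// ltW// ltr_wpDr.
  have h1 : b ^+ 2 * b ^+ 2 <= beta ^+ 2 * b ^+ 2 by rewrite ler_wpM2r.
  have h2 : b ^+ 2 * b ^+ 2 * (v + b ^+ 2) <= beta ^+ 2 * b ^+ 2 * (2 * v).
    by apply: (ler_pM _ _ h1); [exact: mulr_ge0|lra|lra].
  by lra.
have mw'0 := ltW w'0.
have hb : b ^+ 4 / (delta ^+ 2) ^+ 2 <= b ^+ 2 / delta ^+ 2.
  rewrite -[b ^+ 4]/(b ^+ (2 * 2)) exprM -expr_div_n expr2.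
  rewrite ler_piMl ?divr_ge0 ?(ltW d2)//.
  by rewrite ler_pdivrMr// mul1r; lra.
have bd2 : b ^+ 2 <= delta ^+ 2 by lra.
have h1 := heat_step x d2 bd2.
have m0 : 0 <= Num.max w 0 by rewrite le_max lexx orbT.
have mb : Num.max w 0 <= b ^+ 2 by rewrite ge_max b2 andbT; lra.
have h2 : `|heat x (delta ^+ 2 + b ^+ 2) - heat x (delta ^+ 2 + Num.max w 0)|
    <= 16 * (b ^+ 2 / delta ^+ 2).
  have v0 : 0 < delta ^+ 2 + Num.max w 0 by rewrite ltr_wpDr.
  apply: le_trans (@heat_time _ x _ _ v0 _) _; first by rewrite lerD2l.
  rewrite ler_wpM2l// ler_pM// ?invr_ge0 ?(ltW v0)//; first by lra.
    by lra.
  by rewrite lef_pV2 ?posrE// lerDl.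
have h3 : `|2^-1 * (clip_heat delta (x + b) (w - b ^+ 2) +
            clip_heat delta (x - b) (w - b ^+ 2)) - clip_heat delta x w|
    <= 80 * (b ^+ 2 / delta ^+ 2).
  rewrite /clip_heat (max_r mw'0) addr0.
  apply: le_trans (ler_distD (heat x (delta ^+ 2 + b ^+ 2)) _ _) _.
  by lra.
apply: (le_trans h3); rewrite /potential w'0 (max_r mw'0) addr0.
rewrite (max_l (_ : 0 <= - (w - b ^+ 2))) ?oppr_ge0//.
have i0 : 0 <= (delta ^+ 2)^-1 by rewrite invr_ge0 ltW.
have bi : 0 <= b ^+ 2 / delta ^+ 2 by rewrite divr_ge0 // ltW.
have bbi : b ^+ 2 / delta ^+ 2 <= beta ^+ 2 / delta ^+ 2 by rewrite ler_wpM2r.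
have mono : beta ^+ 2 / (delta ^+ 2 + Num.max w 0) <= beta ^+ 2 / delta ^+ 2.
  by rewrite ler_wpM2l ?sqr_ge0// lef_pV2 ?posrE ?lerDl// ltr_wpDr.
have [w0|] := boolP (w < 0).
  rewrite (max_r (ltW w0)) (max_l (_ : 0 <= - w)) ?oppr_ge0 ?(ltW w0)// addr0.
  have -> : - (w - b ^+ 2) / delta ^+ 2 = - w / delta ^+ 2 + b ^+ 2 / delta ^+ 2.
    by field; rewrite gt_eqF.
  by lra.
rewrite -leNgt => w0; rewrite (max_r (_ : - w <= 0)) ?oppr_le0// mul0r.
have : 0 <= - (w - b ^+ 2) / delta ^+ 2 by rewrite mulr_ge0//; lra.
by lra.
Qed.

Lemma clip_heat_final delta x w : 0 < delta ->
  `|clip_heat delta x w - heat x (delta ^+ 2)| <= 16 * (`|w| / delta ^+ 2).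
Proof.
move=> d0; have d2 : 0 < delta ^+ 2 by rewrite exprn_gt0.
have m0 : 0 <= Num.max w 0 by rewrite le_max lexx orbT.
apply: le_trans (@heat_time _ x _ _ d2 _) _; first by rewrite lerDl.
rewrite addrC addKr ler_wpM2l// ler_wpM2r ?invr_ge0 ?(ltW d2)//.
by rewrite ge_max ler_norm normr_ge0.
Qed.

End clipped_heat.

(** * Dyadic filtration and dyadic means *)

Section dyadic.
Context {R : realType}.
Implicit Types (x y : R) (N M l n : nat).

(** Measurability for the sigma-algebra generated by the dyadic intervals of
length 2^-N. *)
Definition adapted (T : Type) N (f : R -> T) :=
  forall x y, Num.floor (2 ^+ N * x) = Num.floor (2 ^+ N * y) -> f x = f y.

(** The binary digits of x at one level are those at the next level with the last
digit dropped. *)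
Lemma floor_double x (z : int) :
  Num.floor (2 * x) = z -> 2 * Num.floor x <= z < 2 * Num.floor x + 2.
Proof.
move=> <-; have /andP[h1 h2] := floor_itv x.
apply/andP; split.
  by rewrite floor_ge_int intrM ler_wpM2l.
rewrite floor_lt_int rmorphD/= intrM.
by move: h2; rewrite rmorphD/=; lra.
Qed.

Lemma floor_dyadic_coarsen N x y :
  Num.floor (2 ^+ N.+1 * x) = Num.floor (2 ^+ N.+1 * y) ->
  Num.floor (2 ^+ N * x) = Num.floor (2 ^+ N * y).
Proof.
rewrite exprS -!mulrA => e.
have := floor_double e; have := floor_double (erefl (Num.floor (2 * (2 ^+ N * y)))).
by lia.
Qed.

Lemma adapted_le (T : Type) N M (f : R -> T) :
  (N <= M)%N -> adapted N f -> adapted M f.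
Proof.
move=> NM af; elim: M NM => [|M IH]; first by rewrite leqn0 => /eqP <-.
rewrite leq_eqVlt => /predU1P[<- //|]; rewrite ltnS => /IH aM x y e.
exact/aM/floor_dyadic_coarsen.
Qed.

Lemma adapted_sum (I : Type) (r : seq I) (P : pred I) N (F : I -> R -> R) :
  (forall i, P i -> adapted N (F i)) ->
  adapted N (fun x => \sum_(i <- r | P i) F i x).
Proof. by move=> aF x y e; apply: eq_bigr => i Pi; exact: aF. Qed.

Lemma rademacher0E x :
  rademacher0 x = if Num.floor (2 * x) < 2 * Num.floor x + 1 then 1 else -1.
Proof.
rewrite /rademacher0 floor_lt_int rmorphD/= intrM.
by congr (if _ then _ else _); apply/idP/idP; lra.
Qed.

Lemma adapted_rademacher l : adapted l.+1 (@rademacher R l).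
Proof.
move=> x y e; rewrite /rademacher !rademacher0E !mulrA -exprS e.
by rewrite (floor_dyadic_coarsen e).
Qed.

Lemma sqr_rademacher l x : rademacher l x ^+ 2 = 1.
Proof. by rewrite /rademacher /rademacher0; case: ifP => _; rewrite ?sqrrN expr1n. Qed.

Definition dyadic N (i : nat) : R := i%:R / 2 ^+ N.

Lemma dyadicE N i : 2 ^+ N * dyadic N i = i%:R.
Proof. by rewrite mulrC divfK// expf_neq0. Qed.

Lemma dyadicS_even N i : dyadic N.+1 (2 * i) = dyadic N i.
Proof.
by rewrite /dyadic natrM exprS invfM mulrACA divff ?mul1r.
Qed.

Lemma dyadicS_odd N i : 2 ^+ N * dyadic N.+1 (2 * i).+1 = i%:R + 2^-1.
Proof.
apply: (@mulfI _ 2) => //.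
by rewrite mulrA -exprS dyadicE -natr1 natrM; field.
Qed.

Lemma floor_half i : Num.floor (i%:R + 2^-1 : R) = i.
Proof.
apply: floor_def; rewrite rmorphD/= pmulrn.
by apply/andP; split; lra.
Qed.

Lemma adapted_dyadicS (T : Type) N (f : R -> T) i : adapted N f ->
  f (dyadic N.+1 (2 * i).+1) = f (dyadic N i).
Proof.
apply; rewrite dyadicS_odd floor_half dyadicE.
by rewrite -[i%:R]/(i%:~R) intrKfloor.
Qed.

Lemma rademacher_even N i : rademacher N (dyadic N i) = 1.
Proof.
rewrite /rademacher /rademacher0 dyadicE -[i%:R]/(i%:~R) intrKfloor subrr.
by rewrite invr_gt0 ltr0n.
Qed.

Lemma rademacher_odd N i : rademacher N (dyadic N.+1 (2 * i).+1) = -1.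
Proof.
by rewrite /rademacher /rademacher0 dyadicS_odd floor_half addrC addKr ltxx.
Qed.

(** For a function adapted to a level at most N this is its integral over
[0, 1). *)
Definition dmean N (f : R -> R) : R :=
  (\sum_(0 <= i < 2 ^ N) f (dyadic N i)) / 2 ^+ N.

Lemma sum_nat_double (F : nat -> R) n :
  \sum_(0 <= i < 2 * n) F i = \sum_(0 <= i < n) (F (2 * i)%N + F (2 * i).+1).
Proof.
elim: n => [|n IH]; first by rewrite muln0 !big_geq.
by rewrite mulnS addSn addSn add0n !big_nat_recr//= IH addrA.
Qed.

Lemma dmeanS N f : dmean N.+1 f =
  (\sum_(0 <= i < 2 ^ N)
     2^-1 * (f (dyadic N i) + f (dyadic N.+1 (2 * i).+1))) / 2 ^+ N.
Proof.
rewrite /dmean expnS sum_nat_double -mulr_sumr exprS invfM.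
under eq_bigr do rewrite dyadicS_even.
by rewrite mulrCA mulrA.
Qed.

Lemma dmean_refine N f : adapted N f -> dmean N.+1 f = dmean N f.
Proof.
move=> af; rewrite dmeanS /dmean; congr (_ / _).
by apply: eq_bigr => i _; rewrite adapted_dyadicS//; field.
Qed.

Lemma dmean_widen N M f : (N <= M)%N -> adapted N f -> dmean M f = dmean N f.
Proof.
move=> NM af; elim: M NM => [|M IH]; first by rewrite leqn0 => /eqP <-.
rewrite leq_eqVlt => /predU1P[<- //|]; rewrite ltnS => NM.
by rewrite dmean_refine ?IH//; exact: adapted_le af.
Qed.

Lemma eq_dmean N f g : f =1 g -> dmean N f = dmean N g.
Proof. by move=> fg; congr (_ / _); apply: eq_bigr => i _. Qed.

(** The sign r_l is fair and independent of the first l binary digits: each dyadic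
interval of level l splits into a half with r_l = 1 and a half with r_l = -1. *)
Lemma dmean_rademacher l M (h : R -> R -> R) : (l < M)%N ->
  (forall s, adapted l (h^~ s)) ->
  dmean M (fun x => h x (rademacher l x)) =
  dmean M (fun x => 2^-1 * (h x 1 + h x (-1))).
Proof.
move=> lM ah; rewrite (@dmean_widen l.+1)//; last first.
  move=> x y e; rewrite (adapted_rademacher e).
  by apply: (ah _ x y); exact: floor_dyadic_coarsen.
rewrite (@dmean_widen l M)//; last first.
- move=> x y e.
  by rewrite (ah 1 x y e) (ah (-1) x y e).
- exact: ltnW.
rewrite dmeanS /dmean; congr (_ / _).
apply: eq_bigr => i _; rewrite rademacher_even rademacher_odd.
by rewrite (@adapted_dyadicS _ _ (h^~ (-1))).
Qed.

Lemma dmean_cst N c : dmean N (fun=> c) = c.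
Proof.
rewrite /dmean big_const_nat subn0 iter_addr_0 -[c *+ _]mulr_natr natrX.
by rewrite mulfK// expf_neq0.
Qed.

Lemma dmeanD N f g : dmean N (fun x => f x + g x) = dmean N f + dmean N g.
Proof. by rewrite /dmean big_split mulrDl. Qed.

Lemma dmeanZ N c f : dmean N (fun x => c * f x) = c * dmean N f.
Proof. by rewrite /dmean -mulr_sumr mulrA. Qed.

Lemma dmeanB N f g : dmean N (fun x => f x - g x) = dmean N f - dmean N g.
Proof.
rewrite -[- dmean N g]mulN1r -dmeanZ -dmeanD.
by apply: eq_dmean => x; rewrite mulN1r.
Qed.

Lemma dmean_sum (I : Type) (r : seq I) (P : pred I) N (F : I -> R -> R) :
  dmean N (fun x => \sum_(i <- r | P i) F i x) =
  \sum_(i <- r | P i) dmean N (F i).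
Proof. by rewrite /dmean exchange_big/= mulr_suml. Qed.

Lemma le_dmean N f g : (forall x, f x <= g x) -> dmean N f <= dmean N g.
Proof.
move=> fg; rewrite ler_wpM2r ?invr_ge0 ?exprn_ge0//.
by apply: ler_sum => i _.
Qed.

Lemma dmean_ge0 N f : (forall x, 0 <= f x) -> 0 <= dmean N f.
Proof. by move=> f0; rewrite -(dmean_cst N 0); apply: le_dmean. Qed.

Lemma ler_norm_dmean N f : `|dmean N f| <= dmean N (fun x => `|f x|).
Proof.
rewrite ler_norml; apply/andP; split.
  rewrite -mulN1r -dmeanZ; apply: le_dmean => x.
  by rewrite mulN1r lerNl -normrN ler_norm.
by apply: le_dmean => x; exact: ler_norm.
Qed.

(** Nonnegativity of the variance of |f|. *)
Lemma sqr_dmean_norm_le N f :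
  dmean N (fun x => `|f x|) ^+ 2 <= dmean N (fun x => f x ^+ 2).
Proof.
set e := dmean N _.
have : 0 <= dmean N (fun x => (`|f x| - e) ^+ 2).
  by apply: dmean_ge0 => x; exact: sqr_ge0.
have -> : dmean N (fun x => (`|f x| - e) ^+ 2) =
    dmean N (fun x => f x ^+ 2) - 2 * e * e + e ^+ 2.
  rewrite -[RHS]/(_ - 2 * e * dmean N (fun x => `|f x|) + _).
  rewrite -dmeanZ -dmeanB -[X in _ + X](dmean_cst N) -dmeanD.
  apply: eq_dmean => x; rewrite -(real_normK (num_real (f x))); ring.
by lra.
Qed.

End dyadic.

(** * Normal approximation of dyadic martingales *)

Lemma telescope_le (R : realDomainType) (u p : nat -> R) (c : R) n :
  (forall j, (j < n)%N -> `|u j.+1 - u j| <= c * (p j.+1 - p j)) ->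
  `|u n - u 0%N| <= c * (p n - p 0%N).
Proof.
elim: n => [|n IH] H; first by rewrite !subrr normr0 mulr0.
apply: le_trans (ler_distD (u n) _ _) _.
rewrite -(subrK (p n) (p n.+1)) -addrA mulrDr lerD ?H// IH// => j jn.
exact/H/ltnW.
Qed.

Section dyadic_martingale.
Context {R : realType}.
Variables (M : nat) (b : nat -> R -> R) (beta delta : R).
Hypothesis b_adapted : forall j, adapted j (b j).
Hypothesis b_le : forall j x, `|b j x| <= beta.
Hypothesis delta_gt0 : 0 < delta.
Hypothesis beta_le : beta <= delta.
Notation Phi := (@gauss_cdf R).

(** The martingale with increments b_i r_i. *)
Definition transform j x : R := \sum_(0 <= i < j) b i x * rademacher i x.

Definition variance_left j x : R := 1 - \sum_(0 <= i < j) b i x ^+ 2.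

Let adapted_transform j : adapted j (transform j).
Proof.
move=> x y e; apply: eq_big_nat => i /andP[_ ij].
congr (_ * _); first exact: (adapted_le (ltnW ij) (@b_adapted i)).
exact: (adapted_le ij (@adapted_rademacher _ i)).
Qed.

Let adapted_variance_left j : adapted j (variance_left j).
Proof.
move=> x y e; congr (1 - _); apply: eq_big_nat => i /andP[_ ij].
by congr (_ ^+ 2); exact: (adapted_le (ltnW ij) (@b_adapted i)).
Qed.

Let transformS j x :
  transform j.+1 x = transform j x + b j x * rademacher j x.
Proof. by rewrite /transform big_nat_recr. Qed.

Let variance_leftS j x : variance_left j.+1 x = variance_left j x - b j x ^+ 2.
Proof. by rewrite /variance_left big_nat_recr//= opprD addrA. Qed.

Lemma dmean_clip_heat_step t j : (j < M)%N ->
  `|dmean M (fun x => clip_heat delta (t - transform j.+1 x) (variance_left j.+1 x))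
    - dmean M (fun x => clip_heat delta (t - transform j x) (variance_left j x))|
  <= 128 * (dmean M (fun x => potential beta delta (variance_left j.+1 x))
            - dmean M (fun x => potential beta delta (variance_left j x))).
Proof.
move=> jM.
have -> : dmean M (fun x => clip_heat delta (t - transform j.+1 x) (variance_left j.+1 x))
   = dmean M (fun x => 2^-1 *
       (clip_heat delta (t - transform j x + b j x) (variance_left j x - b j x ^+ 2) +
        clip_heat delta (t - transform j x - b j x) (variance_left j x - b j x ^+ 2))).
  (* for a fixed sign s, [h x s] depends on the first j binary digits of x only *)
  pose h x s := clip_heat delta (t - transform j x - b j x * s)
    (variance_left j x - b j x ^+ 2).
  transitivity (dmean M (fun x => h x (rademacher j x))).
    apply: eq_dmean => x.
    by rewrite /h transformS variance_leftS opprD addrA.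
  rewrite (@dmean_rademacher _ j M h)//; last first.
    move=> s x y e; rewrite /h.
    by rewrite (adapted_transform e) (adapted_variance_left e) (b_adapted e).
  apply: eq_dmean => x; rewrite /h mulr1 mulrN1 opprK.
  by congr (_ * _); rewrite addrC.
rewrite -!dmeanB -dmeanZ; apply: le_trans (ler_norm_dmean _ _) _.
apply: le_dmean => x.
rewrite variance_leftS; exact: clip_heat_step.
Qed.

(** The errors of the single steps telescope along the potential. *)
Lemma dmean_clip_heat t :
  `|dmean M (fun x => clip_heat delta (t - transform M x) (variance_left M x))
    - clip_heat delta t 1|
  <= 128 * dmean M (fun x => potential beta delta (variance_left M x)).
Proof.
pose u j := dmean M (fun x => clip_heat delta (t - transform j x) (variance_left j x)).
pose p j := dmean M (fun x => potential beta delta (variance_left j x)).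
have u0 : u 0%N = clip_heat delta t 1.
  rewrite -(dmean_cst M (clip_heat _ _ _)); apply: eq_dmean => x.
  by rewrite /transform /variance_left !big_geq// !subr0.
have p0 : 0 <= p 0%N by apply: dmean_ge0 => x; exact: potential_ge0.
rewrite -u0; apply: (@le_trans _ _ (128 * (p M - p 0%N))).
  by apply: telescope_le => j; exact: dmean_clip_heat_step.
by rewrite ler_wpM2l// gerBl.
Qed.

Lemma heat_sqr (x d : R) : 0 < d -> heat x (d ^+ 2) = Phi (x / d).
Proof. by move=> d0; rewrite /heat sqrtr_sqr gtr0_norm. Qed.

Notation D := (dmean M (fun x => `|variance_left M x|)).

(** The truncated heat flow starts at variance 1 + delta^2 instead of 1 and ends at
delta^2 plus the positive part of the variance left over; both discrepancies are
controlled by [heat_time]. *)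
Lemma dmean_smoothed t :
  `|dmean M (fun x => Phi ((t - transform M x) / delta)) - Phi t|
  <= 256 * (beta ^+ 2 / delta ^+ 2) + 144 * (D / delta ^+ 2) + 16 * delta ^+ 2.
Proof.
have d2 : 0 < delta ^+ 2 by rewrite exprn_gt0.
have h1 := dmean_clip_heat t.
have h2 : dmean M (fun x => potential beta delta (variance_left M x)) <=
    2 * (beta ^+ 2 / delta ^+ 2) + D / delta ^+ 2.
  rewrite -[X in X + _](dmean_cst M) (mulrC D) -dmeanZ -dmeanD.
  apply: le_dmean => x; rewrite [_^-1 * _]mulrC.
  exact: le_potential.
have h3 : `|dmean M (fun x => clip_heat delta (t - transform M x) (variance_left M x))
   - dmean M (fun x => Phi ((t - transform M x) / delta))| <= 16 * (D / delta ^+ 2).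
  rewrite -dmeanB; apply: le_trans (ler_norm_dmean _ _) _.
  rewrite (mulrC D) -!dmeanZ; apply: le_dmean => x.
  by rewrite -heat_sqr// [_^-1 * _]mulrC; exact: clip_heat_final.
have h4 : `|clip_heat delta t 1 - Phi t| <= 16 * delta ^+ 2.
  have -> : Phi t = heat t 1 by rewrite /heat sqrtr1 divr1.
  rewrite /clip_heat max_l//.
  have := @heat_time _ t 1 (delta ^+ 2 + 1) ltr01.
  by rewrite divr1 addrK; apply; lra.
apply: le_trans (ler_distD (clip_heat delta t 1) _ _) _.
set X := dmean M (fun x => Phi _) in h3 *.
set Y := dmean M (fun x => clip_heat _ _ _) in h1 h3.
set Z := dmean M (fun x => potential _ _ _) in h1 h2.
have := ler_distD Y X (clip_heat delta t 1); rewrite (distrC X Y).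
by lra.
Qed.

Definition kolmogorov_const : R := 256 * (2 * tail_const + 1) + 2 * tail_const.

(** The smoothed distribution function E Phi ((t - S) / delta) is close to Phi,
which is Lipschitz; by [indicator_gauss_cdf] the true distribution function of S
differs from the smoothed one by at most a multiple of an increment of the latter
over [t - delta, t + delta]. *)
Theorem dyadic_martingale_kolmogorov t : delta <= 1 ->
  `|dmean M (fun x => (transform M x <= t)%R%:R) - Phi t|
  <= kolmogorov_const * (delta + beta ^+ 2 / delta ^+ 2 + D / delta ^+ 2).
Proof.
move=> d1; have d2 : 0 < delta ^+ 2 by rewrite exprn_gt0.
pose Psi t := dmean M (fun x => Phi ((t - transform M x) / delta)).
pose E := 256 * (beta ^+ 2 / delta ^+ 2) + 144 * (D / delta ^+ 2) + 16 * delta ^+ 2.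
have hPsi s : `|Psi s - Phi s| <= E by exact: dmean_smoothed.
have h1 : `|dmean M (fun x => (transform M x <= t)%R%:R) - Psi t|
    <= tail_const * (Psi (t + delta) - Psi (t - delta)).
  rewrite -!dmeanB -dmeanZ; apply: le_trans (ler_norm_dmean _ _) _.
  apply: le_dmean => x.
  have := indicator_gauss_cdf ((t - transform M x) / delta).
  rewrite ler_pdivlMr// mul0r subr_ge0 => /le_trans; apply.
  have -> : (t + delta - transform M x) / delta = (t - transform M x) / delta + 1.
    by field; rewrite gt_eqF.
  have -> : (t - delta - transform M x) / delta = (t - transform M x) / delta - 1.
    by field; rewrite gt_eqF.
  by [].
have h2 : Phi (t + delta) - Phi (t - delta) <= 2 * delta.
  apply: le_trans (ler_norm _) _; apply: le_trans (gauss_cdf_lip _ _) _.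
  rewrite (_ : t + delta - (t - delta) = 2 * delta); last by ring.
  by rewrite ger0_norm// mulr_ge0// ltW.
have K2 := @tail_const_ge2 R.
have K0 : 0 <= @tail_const R by exact: le_trans K2.
have h3 : tail_const * (Psi (t + delta) - Psi (t - delta)) <=
    tail_const * (2 * E + 2 * delta).
  rewrite ler_wpM2l//.
  have := hPsi (t + delta); have := hPsi (t - delta).
  by rewrite !ler_norml => /andP[? ?] /andP[? ?]; lra.
have D0 : 0 <= D / delta ^+ 2.
  by rewrite divr_ge0 ?(ltW d2)//; apply: dmean_ge0.
have b0 : 0 <= beta ^+ 2 / delta ^+ 2 by rewrite divr_ge0 ?(ltW d2)// sqr_ge0.
have EE : E <= 256 * (delta + beta ^+ 2 / delta ^+ 2 + D / delta ^+ 2).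
  have : delta ^+ 2 <= delta by rewrite expr2 ler_piMl// ltW.
  by rewrite /E; lra.
have hd : delta <= delta + beta ^+ 2 / delta ^+ 2 + D / delta ^+ 2 by lra.
have h4 := hPsi t.
have h5 : (2 * tail_const + 1) * E + 2 * tail_const * delta <=
   kolmogorov_const * (delta + beta ^+ 2 / delta ^+ 2 + D / delta ^+ 2).
  rewrite /kolmogorov_const [leRHS]mulrDl; apply: lerD.
    by rewrite (mulrC 256) -mulrA ler_wpM2l//; lra.
  by rewrite ler_wpM2l//; lra.
move: h1 h4; rewrite !ler_norml.
by move=> /andP[? ?] /andP[? ?]; apply/andP; split; lra.
Qed.

End dyadic_martingale.

(** * Binary digits and orthogonality of Walsh functions *)

Section walsh_digits.
Context {R : realType}.
Implicit Types (x : R) (N M m j i l : nat).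

(** The factor of the Walsh function that belongs to the binary digits of m below
position N. *)
Definition walsh_low N m x : R :=
  \prod_(0 <= i < N | odd (m %/ 2 ^ i)) rademacher i x.

Lemma walsh_lowS N m x : walsh_low N.+1 m x =
  walsh_low N m x * (if odd (m %/ 2 ^ N) then rademacher N x else 1).
Proof. by rewrite /walsh_low big_mkcond big_nat_recr//= -big_mkcond. Qed.

Lemma walsh_low_widen N N' m x : (m < 2 ^ N)%N -> (N <= N')%N ->
  walsh_low N' m x = walsh_low N m x.
Proof.
move=> mN; elim: N' => [|N' IH]; first by rewrite leqn0 => /eqP ->.
rewrite leq_eqVlt => /predU1P[-> //|]; rewrite ltnS => NN'.
rewrite walsh_lowS IH// divn_small ?mulr1//.
by rewrite (leq_trans mN)// leq_exp2l.
Qed.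

Lemma walshE N m x : (m < 2 ^ N)%N -> walsh m x = walsh_low N m x.
Proof.
move=> mN; rewrite -(walsh_low_widen x mN (leq_maxl N m)).
have mm : (m < 2 ^ m)%N by exact: ltn_expl.
rewrite (walsh_low_widen x mm (leq_maxr N m)).
by rewrite /walsh /walsh_low big_mkord.
Qed.

Lemma walsh_block j m x : (2 ^ j <= m < 2 ^ j.+1)%N ->
  walsh m x = walsh_low j m x * rademacher j x.
Proof.
move=> /andP[jm mj]; rewrite (walshE x mj) walsh_lowS.
have -> : (m %/ 2 ^ j = 1)%N.
  apply/eqP; rewrite eqn_leq -ltnS ltn_divLR ?expn_gt0// -expnS mj/=.
  by rewrite divn_gt0 ?expn_gt0.
by [].
Qed.

Lemma adapted_walsh_low N m : adapted N (@walsh_low N m).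
Proof.
move=> x y e; rewrite /walsh_low !big_mkord; apply: eq_bigr => i _.
exact: (adapted_le (ltn_ord i) (@adapted_rademacher _ i)).
Qed.

Lemma sqr_walsh_low N m x : walsh_low N m x ^+ 2 = 1.
Proof.
by rewrite /walsh_low -prodrXl big1// => i _; rewrite sqr_rademacher.
Qed.

Lemma normr_walsh_low N m x : `|walsh_low N m x| = 1.
Proof.
apply/eqP; rewrite -sqrp_eq1 ?normr_ge0//.
by rewrite real_normK ?num_real// sqr_walsh_low.
Qed.

(** At the highest digit where m and m' differ the product has exactly one
Rademacher factor, higher digits contribute squares equal to 1, and what remains
depends on earlier digits of x only. *)
Lemma dmean_walsh_low_orth M N m m' i l (g : R -> R) : (N <= M)%N ->
  (i <= l < N)%N -> odd (m %/ 2 ^ l) != odd (m' %/ 2 ^ l) -> adapted i g ->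
  dmean M (fun x => walsh_low N m x * walsh_low N m' x * g x) = 0.
Proof.
move=> + + ml ag; elim: N => [|N IH]; first by rewrite ltn0 andbF.
move=> NM /andP[il lN]; have [e|ne] := eqVneq (odd (m %/ 2 ^ N)) (odd (m' %/ 2 ^ N)).
  have lN' : (l < N)%N.
    rewrite ltn_neqAle -ltnS lN andbT; apply/eqP => lN'.
    by move: ml; rewrite lN' e eqxx.
  rewrite -(IH (ltnW NM) _); last by rewrite il.
  apply: eq_dmean => x; rewrite !walsh_lowS e; case: ifP => _.
    rewrite -[RHS]mulr1 -(sqr_rademacher N x); ring.
  by rewrite !mulr1.
pose h x s := walsh_low N m x * walsh_low N m' x * g x * s.
transitivity (dmean M (fun x => h x (rademacher N x))).
  apply: eq_dmean => x; rewrite /h !walsh_lowS.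
  by move: ne; case: odd; case: odd => // _; ring.
rewrite (@dmean_rademacher _ N M h)//.
  rewrite -[RHS](dmean_cst M); apply: eq_dmean => x; rewrite /h; ring.
move=> s x y e; have iN : (i <= N)%N by rewrite (leq_trans il).
by rewrite /h (adapted_walsh_low m e) (adapted_walsh_low m' e) (adapted_le iN ag e).
Qed.

(** Two integers with the same leading digit that differ after deletion of the
last i digits differ in one of the digits between. *)
Lemma odd_digit_neq i j m m' : (2 ^ j <= m < 2 ^ j.+1)%N ->
  (2 ^ j <= m' < 2 ^ j.+1)%N -> (i <= j)%N -> (m %/ 2 ^ i != m' %/ 2 ^ i)%N ->
  exists2 l, (i <= l < j)%N & odd (m %/ 2 ^ l) != odd (m' %/ 2 ^ l).
Proof.
move=> hm hm' ij; rewrite -(subKn ij); move: (j - i)%N (leq_subr i j) => r.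
elim: r => [|r IH] rj.
  rewrite subn0.
  have top k : (2 ^ j <= k < 2 ^ j.+1)%N -> (k %/ 2 ^ j = 1)%N.
    move=> /andP[jk kj]; apply/eqP; rewrite eqn_leq -ltnS ltn_divLR ?expn_gt0//.
    by rewrite -expnS kj/= divn_gt0 ?expn_gt0.
  by rewrite !top.
have e : (j - r = (j - r.+1).+1)%N by rewrite subnSK.
have lt_j : (j - r.+1 < j)%N by rewrite -e leq_subr.
have [same|diff _] := eqVneq (m %/ 2 ^ (j - r))%N (m' %/ 2 ^ (j - r))%N; last first.
  have [l /andP[lr lj] ml] := IH (ltnW rj) diff.
  by exists l => //; rewrite lj andbT (leq_trans _ lr)// e.
rewrite (divn_eq (m %/ _) 2) (divn_eq (m' %/ _) 2) -!divnMA -!expnSr -e same.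
rewrite !modn2 eqn_add2l => h; exists (j - r.+1)%N; first by rewrite leqnn.
by apply: contra h => /eqP ->.
Qed.

End walsh_digits.

(** * Sums of Walsh functions grouped by leading digit *)

Lemma sqr_sum_le (R : realDomainType) (I : Type) (r : seq I) (F : I -> R) :
  (\sum_(k <- r) F k) ^+ 2 <= (size r)%:R * \sum_(k <- r) F k ^+ 2.
Proof.
have -> : (size r)%:R * \sum_(k <- r) F k ^+ 2 =
    \sum_(k <- r) \sum_(l <- r) F k ^+ 2.
  rewrite mulr_sumr; apply: eq_bigr => k _.
  by rewrite big_const_seq count_predT iter_addr_0 mulr_natl.
have h : 2 * (\sum_(k <- r) F k) ^+ 2 <= 2 * \sum_(k <- r) \sum_(l <- r) F k ^+ 2.
  rewrite [leRHS]mulr_natl mulr2n [X in _ <= _ + X]exchange_big -big_split/=.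
  rewrite expr2 big_distrlr/= mulr_sumr; apply: ler_sum => k _.
  rewrite -big_split mulr_sumr; apply: ler_sum => l _ /=.
  by have := sqr_ge0 (F k - F l); rewrite !expr2; lra.
by rewrite ler_pM2l in h.
Qed.

Section walsh_blocks.
Context {R : realType}.
Variables (n K M : nat) (m : nat -> nat) (c : nat -> R) (d : R).

Notation top k := (trunc_log 2 (m k)).
Notation r := (index_iota 1 n.+1).

Hypothesis m_gt0 : forall k, k \in r -> (0 < m k)%N.
Hypothesis m_lt : forall k, k \in r -> (m k < 2 ^ M)%N.
(* the elements of a block are told apart by the K digits that follow the leading
   one *)
Hypothesis m_sep : forall k l, k \in r -> l \in r -> k != l -> top k = top l ->
  (m k %/ 2 ^ (top k - K) != m l %/ 2 ^ (top k - K))%N.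
Hypothesis c_le : forall k, k \in r -> `|c k| <= d.
Hypothesis d_ge0 : 0 <= d.

Definition block j := [seq k <- r | top k == j].

Definition block_coef j (x : R) : R :=
  \sum_(k <- block j) c k * walsh_low j (m k) x.

Definition block_var j : R := \sum_(k <- block j) c k ^+ 2.

(** The fluctuation of the conditional variance of the increment at level j around
its mean. *)
Definition block_excess j (x : R) : R := block_coef j x ^+ 2 - block_var j.

Let P : R := (2 ^ K.+1)%:R.

Let P_ge1 : 1 <= P.
Proof. by rewrite ler1n expn_gt0. Qed.

Lemma mem_block k j : k \in block j ->
  [/\ k \in r, top k = j & (2 ^ j <= m k < 2 ^ j.+1)%N].
Proof.
rewrite mem_filter => /andP[/eqP kj kr]; split=> //.
by rewrite -kj trunc_logP ?m_gt0// trunc_log_ltn.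
Qed.

Lemma sum_blocks (F : nat -> nat -> R) :
  \sum_(0 <= j < M) \sum_(k <- block j) F k j = \sum_(k <- r) F k (top k).
Proof.
under eq_bigr do rewrite big_filter big_mkcond.
rewrite exchange_big /= big_seq [RHS]big_seq; apply: eq_bigr => k kr.
rewrite -big_mkcond/=.
under eq_bigl do rewrite eq_sym.
rewrite big_nat1_eq leq0n /=; case: ifP => // /negP[].
rewrite -(@ltn_exp2l 2)//; apply: leq_ltn_trans (m_lt kr).
by rewrite trunc_logP// m_gt0.
Qed.

Lemma transform_block x :
  transform block_coef M x = \sum_(k <- r) c k * walsh (m k) x.
Proof.
rewrite /transform.
under eq_bigr do rewrite mulr_suml.
rewrite (sum_blocks (fun k j => c k * walsh_low j (m k) x * rademacher j x)).
rewrite !big_seq; apply: eq_bigr => k kr.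
by rewrite -mulrA -walsh_block// trunc_logP ?m_gt0// trunc_log_ltn.
Qed.

Lemma sum_block_var : \sum_(0 <= j < M) block_var j = \sum_(k <- r) c k ^+ 2.
Proof. by rewrite (sum_blocks (fun k _ => c k ^+ 2)). Qed.

Lemma block_uniq j : uniq (block j).
Proof. by rewrite filter_uniq// iota_uniq. Qed.

(** The leading K + 1 binary digits tell the elements of a block apart. *)
Lemma size_block j : (size (block j))%:R <= P.
Proof.
rewrite ler_nat -(size_map (fun k => m k %/ 2 ^ (j - K))%N) -[leqRHS](size_iota 0).
apply: uniq_leq_size.
  rewrite map_inj_in_uniq ?block_uniq// => k l kB lB e.
  have [kr kj _] := mem_block kB; have [lr lj _] := mem_block lB.
  apply/eqP; apply/negPn/negP => kl.
  have := m_sep kr lr kl; rewrite kj lj => /(_ erefl).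
  by rewrite e eqxx.
move=> _ /mapP[k kB ->]; have [kr kj /andP[_ mk]] := mem_block kB.
rewrite mem_iota leq0n add0n ltn_divLR ?expn_gt0//.
apply: (leq_trans mk); rewrite -expnD leq_exp2l//; lia.
Qed.

Lemma adapted_block_coef j : adapted j (block_coef j).
Proof.
by apply: adapted_sum => k _ x y e; rewrite (adapted_walsh_low (m k) e).
Qed.

Lemma adapted_block_excess j : adapted j (block_excess j).
Proof. by move=> x y e; rewrite /block_excess (adapted_block_coef e). Qed.

Lemma block_coef_le j x : `|block_coef j x| <= P * d.
Proof.
apply: le_trans (ler_norm_sum _ _ _) _.
apply: (@le_trans _ _ (\sum_(k <- block j) d)).
  rewrite big_seq [leRHS]big_seq; apply: ler_sum => k /mem_block[kr _ _].
  by rewrite normrM normr_walsh_low mulr1 c_le.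
rewrite big_const_seq count_predT iter_addr_0 -mulr_natl.
by rewrite ler_wpM2r// size_block.
Qed.

Lemma block_var_ge0 j : 0 <= block_var j.
Proof. by apply: sumr_ge0 => k _; exact: sqr_ge0. Qed.

Lemma block_var_le j : block_var j <= P * d ^+ 2.
Proof.
apply: (@le_trans _ _ (\sum_(k <- block j) d ^+ 2)).
  rewrite /block_var big_seq [leRHS]big_seq.
  apply: ler_sum => k /mem_block[kr _ _].
  rewrite -(real_normK (num_real (c k))) lerXn2r ?nnegrE//; exact: c_le.
rewrite big_const_seq count_predT iter_addr_0 -mulr_natl.
by rewrite ler_wpM2r ?exprn_ge0// size_block.
Qed.

Lemma block_excess_le j x : `|block_excess j x| <= P * block_var j.
Proof.
have v0 := block_var_ge0 j.
have h : block_coef j x ^+ 2 <= P * block_var j.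
  apply: le_trans (sqr_sum_le _ _) _.
  have -> : \sum_(k <- block j) (c k * walsh_low j (m k) x) ^+ 2 = block_var j.
    by apply: eq_bigr => k _; rewrite exprMn sqr_walsh_low mulr1.
  by rewrite ler_wpM2r// size_block.
have := sqr_ge0 (block_coef j x); have : block_var j <= P * block_var j.
  by rewrite ler_peMl.
by rewrite /block_excess ler_norml => ? ?; apply/andP; split; lra.
Qed.

(** The diagonal terms of the squared sum are the constants c_k^2. *)
Lemma block_excessE j x : block_excess j x =
  \sum_(k <- block j) \sum_(l <- block j | l != k)
    c k * c l * (walsh_low j (m k) x * walsh_low j (m l) x).
Proof.
rewrite /block_excess /block_coef expr2 big_distrlr/= /block_var -sumrB.
rewrite big_seq [RHS]big_seq; apply: eq_bigr => k kB.
rewrite (bigD1_seq k) ?block_uniq//=.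
rewrite -[X in _ - X]mulr1 -(sqr_walsh_low j (m k) x).
set S := \sum_(_ <- _ | _) _; set S' := \sum_(_ <- _ | _) _.
have -> : S = S' by apply: eq_bigr => l _; ring.
by ring.
Qed.

(** Two distinct indices of a block differ at one of the K digits below the leading
one, so every term of [block_excessE] has mean 0 given the first j - K digits of
x. *)
Lemma dmean_block_excess j (g : R -> R) : (j <= M)%N -> adapted (j - K) g ->
  dmean M (fun x => block_excess j x * g x) = 0.
Proof.
move=> jM ag.
transitivity (dmean M (fun x => \sum_(k <- block j) \sum_(l <- block j | l != k)
    c k * c l * (walsh_low j (m k) x * walsh_low j (m l) x * g x))).
  apply: eq_dmean => x; rewrite block_excessE mulr_suml.
  apply: eq_bigr => k _; rewrite mulr_suml; apply: eq_bigr => l _.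
  by rewrite -!mulrA.
rewrite dmean_sum big_seq big1// => k kB.
rewrite dmean_sum big_seq_cond big1// => l /andP[lB lk].
have [kr kj hk] := mem_block kB; have [lr lj hl] := mem_block lB.
have := @m_sep k l kr lr; rewrite eq_sym lk kj lj => /(_ isT erefl) ne.
have [i ji oi] := odd_digit_neq hk hl (leq_subr _ _) ne.
by rewrite dmeanZ (dmean_walsh_low_orth jM ji oi ag) mulr0.
Qed.

Definition excess j (x : R) : R := \sum_(0 <= i < j) block_excess i x.

Lemma adapted_excess j : adapted j (excess j).
Proof.
move=> x y e; apply: eq_big_nat => i /andP[_ ij].
exact: (adapted_le (ltnW ij) (@adapted_block_excess i)).
Qed.

Lemma excess_recent j x : `|excess j x - excess (j - K) x| <= K%:R * (P ^+ 2 * d ^+ 2).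
Proof.
rewrite /excess (@big_cat_nat _ _ _ (j - K) 0 j) ?leq_subr//=.
rewrite addrAC subrr add0r.
apply: le_trans (ler_norm_sum _ _ _) _.
apply: (@le_trans _ _ (\sum_(j - K <= i < j) P ^+ 2 * d ^+ 2)).
  apply: ler_sum => i _; apply: (le_trans (block_excess_le i x)).
  by rewrite expr2 -mulrA ler_wpM2l ?block_var_le// (le_trans _ P_ge1).
rewrite big_const_nat iter_addr_0 -[leLHS]mulr_natl ler_wpM2r//.
  by rewrite mulr_ge0 ?sqr_ge0.
by rewrite ler_nat; lia.
Qed.

(** The cross term with the excess accumulated before level j - K vanishes by
orthogonality, and the excess accumulated since then is a sum of K terms, each
O(d^2). *)
Lemma dmean_sqr_excessS j : (j < M)%N ->
  dmean M (fun x => excess j.+1 x ^+ 2) <=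
  dmean M (fun x => excess j x ^+ 2) +
  (2 * K%:R + 1) * P ^+ 3 * d ^+ 2 * block_var j.
Proof.
move=> jM; have v0 := block_var_ge0 j.
have P0 : 0 <= P by rewrite (le_trans _ P_ge1).
pose g x := excess (j - K) x.
have ag : adapted (j - K) g by exact: adapted_excess.
have -> : dmean M (fun x => excess j.+1 x ^+ 2) =
  dmean M (fun x => excess j x ^+ 2 +
   (2 * (block_excess j x * g x) +
   (2 * (block_excess j x * (excess j x - g x)) + block_excess j x ^+ 2))).
  by apply: eq_dmean => x; rewrite /excess big_nat_recr//=; ring.
rewrite dmeanD lerD2l dmeanD dmeanZ dmean_block_excess ?(ltnW jM)// mulr0 add0r.
rewrite -[leRHS](dmean_cst M); apply: le_dmean => x.
have h1 := block_excess_le j x; have h2 := excess_recent j x.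
have h3 := block_var_le j.
have h4 : block_excess j x * (excess j x - g x) <=
    (P * block_var j) * (K%:R * (P ^+ 2 * d ^+ 2)).
  apply: le_trans (ler_norm _) _; rewrite normrM.
  by rewrite ler_pM.
have h5 : block_excess j x ^+ 2 <= (P * block_var j) * (P * (P * d ^+ 2)).
  rewrite -(real_normK (num_real _)) expr2 ler_pM//.
  by apply: (le_trans h1); rewrite ler_wpM2l.
have -> : (2 * K%:R + 1) * P ^+ 3 * d ^+ 2 * block_var j =
   2 * ((P * block_var j) * (K%:R * (P ^+ 2 * d ^+ 2))) +
   (P * block_var j) * (P * (P * d ^+ 2)) by ring.
by lra.
Qed.

Lemma dmean_sqr_excess : dmean M (fun x => excess M x ^+ 2) <=
  (2 * K%:R + 1) * P ^+ 3 * d ^+ 2 * \sum_(k <- r) c k ^+ 2.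
Proof.
rewrite -sum_block_var.
have H j : (j <= M)%N -> dmean M (fun x => excess j x ^+ 2) <=
  (2 * K%:R + 1) * P ^+ 3 * d ^+ 2 * \sum_(0 <= i < j) block_var i.
  elim: j => [_|j IH jM].
    rewrite big_geq// mulr0 -[leRHS](dmean_cst M); apply: le_dmean => x.
    by rewrite /excess big_geq// expr0n.
  rewrite big_nat_recr//= mulrDr.
  apply: le_trans (dmean_sqr_excessS jM) _.
  by rewrite lerD2r IH// ltnW.
exact: H.
Qed.

Lemma variance_left_block x : \sum_(k <- r) c k ^+ 2 = 1 ->
  variance_left block_coef M x = - excess M x.
Proof.
move=> c1; rewrite /variance_left -c1 -sum_block_var /excess sumrB opprB.
by [].
Qed.

End walsh_blocks.

(** * From dyadic means to Lebesgue measure *)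

Section lebesgue_dyadic.
Context {R : realType}.
Notation mu := (@lebesgue_measure R).

Lemma dyadicS_gap M k : dyadic M k.+1 - dyadic M k = 2 ^- M :> R.
Proof. by rewrite /dyadic -mulrBl -natr1 [X in X / _](addrAC _ 1) subrr add0r mul1r. Qed.

Lemma floor_dyadic_itv M k (x : R) : dyadic M k <= x < dyadic M k.+1 ->
  Num.floor (2 ^+ M * x) = k.
Proof.
have p : 0 < 2 ^+ M :> R by rewrite exprn_gt0.
move=> /andP[h1 h2]; apply: floor_def; rewrite rmorphD/= -!pmulrn natr1.
by move: h1 h2; rewrite /dyadic ler_pdivrMr// ltr_pdivlMr// (mulrC x) => -> ->.
Qed.

(** Each dyadic interval is contained in A or disjoint from it. *)
Lemma lebesgue_adapted_itv M (A : set R) k : measurable A ->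
  adapted M (\1_A : R -> R) ->
  mu (A `&` `[0, dyadic M k[) =
  ((\sum_(0 <= i < k) \1_A (dyadic M i)) / 2 ^+ M)%:E.
Proof.
move=> mA aA; elim: k => [|k IH].
  by rewrite big_geq// mul0r /dyadic mul0r set_itvco0 setI0 measure0.
have lt_k : dyadic M k < dyadic M k.+1 :> R.
  by rewrite -subr_gt0 dyadicS_gap invr_gt0 exprn_gt0.
have ge_k : 0 <= dyadic M k :> R by rewrite divr_ge0.
rewrite (@itv_bndbnd_setU _ _ _ (BLeft (dyadic M k))) ?bnd_simp ?(ltW lt_k)//.
rewrite setIUr measureU//=; last 3 first.
- exact: measurableI.
- exact: measurableI.
- apply/seteqP; split => x //=.
  rewrite !in_itv/= => -[[_ /andP[_ h']] [_ /andP[h _]]].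
  by move: (le_lt_trans h h'); rewrite ltxx.
rewrite [X in (X + _)%E]IH big_nat_recr//= mulrDl EFinD; congr (_ + _)%E.
have const x : dyadic M k <= x < dyadic M k.+1 -> \1_A x = \1_A (dyadic M k) :> R.
  move=> xk; apply: aA; rewrite (floor_dyadic_itv xk).
  by rewrite (@floor_dyadic_itv M k)// lexx lt_k.
have [kA|kA] := boolP (dyadic M k \in A).
  have -> : A `&` `[dyadic M k, dyadic M k.+1[ = `[dyadic M k, dyadic M k.+1[%classic.
    apply/setIidPr => x /=; rewrite in_itv/= => xk.
    have := const x xk; rewrite !indicE kA.
    by case: (boolP (x \in A)) => [/set_mem//|_ /eqP]; rewrite eq_sym oner_eq0.
  rewrite lebesgue_measure_itv/= lte_fin lt_k -EFinB dyadicS_gap.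
  by rewrite indicE kA mul1r.
have -> : A `&` `[dyadic M k, dyadic M k.+1[ = set0.
  apply/seteqP; split => x //= [/mem_set xA]; rewrite in_itv/= => xk.
  have := const x xk; rewrite !indicE xA (negbTE kA).
  by move/eqP; rewrite oner_eq0.
by rewrite measure0 indicE (negbTE kA) mul0r.
Qed.

Lemma lebesgue01_adapted M (A : set R) : measurable A ->
  adapted M (\1_A : R -> R) -> lebesgue01 R A = (dmean M (\1_A))%:E.
Proof.
move=> mA aA; rewrite /lebesgue01 /mrestr.
have -> : `[0, 1]%classic = `[0, 1[%classic `|` [set 1] :> set R.
  by rewrite setUitv1// bnd_simp.
rewrite setIUr measureU//=; last 3 first.
- exact: measurableI.
- exact: measurableI.
- apply/seteqP; split => x //= -[[_ +] [_ x1]].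
  by rewrite x1 in_itv/= ltxx andbF.
rewrite [X in (_ + X)%E](_ : _ = 0%E) ?adde0; last first.
  by rewrite setI1; case: ifP => _; [exact: lebesgue_measure_set1|exact: measure0].
have -> : 1 = dyadic M (2 ^ M) :> R by rewrite /dyadic natrX divff// expf_neq0.
exact: lebesgue_adapted_itv.
Qed.

Lemma adapted_walsh M m : (m < 2 ^ M)%N -> adapted M (@walsh R m).
Proof.
by move=> mM x y e; rewrite !(walshE _ mM) (adapted_walsh_low m e).
Qed.

Lemma kolmogorov_dist_walsh_le (a : nat -> nat -> R) (m : nat -> nat) n M (B : R) :
  (forall k, k \in index_iota 1 n.+1 -> (m k < 2 ^ M)%N) ->
  (forall t, `|dmean M (fun x => (normalized_walsh_sum a m n x <= t)%R%:R)
               - gauss_cdf t| <= B) ->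
  (kolmogorov_dist (normalized_walsh_sum a m n : {RV (lebesgue01 R) >-> R})
     (normal_prob 0 1) <= B%:E)%E.
Proof.
move=> mM hB; apply: ge_ereal_sup => _ [t _ <-].
rewrite -[X in (_ - X)%E]gauss_cdfE /cdf /distribution /pushforward.
set A := normalized_walsh_sum a m n @^-1` `]-oo, t].
have indA x : \1_A x = (normalized_walsh_sum a m n x <= t)%R%:R :> R.
  rewrite indicE; congr (nat_of_bool _ )%:R.
  by apply/idP/idP => [/set_mem|h]; [|apply/mem_set]; rewrite /A /= in_itv.
have mA : measurable (A : set R).
  have := @measurable_normalized_walsh_sum R a m n measurableT _
    (measurable_itv `]-oo, t]).
  by rewrite setTI.
have aA : adapted M (\1_A : R -> R).
  move=> x y e; rewrite !indA /normalized_walsh_sum /walsh_sum.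
  rewrite !big_seq; congr (nat_of_bool (_ / _ <= _)%R)%:R.
  apply: eq_bigr => k /mM mk; by rewrite (adapted_walsh mk e).
rewrite [X in (X - _)%E](lebesgue01_adapted mA aA) -EFinB/= lee_fin.
by rewrite (eq_dmean M indA).
Qed.

End lebesgue_dyadic.

(** * Triangular arrays and lacunary sequences *)

Section arrays.
Context {R : realType}.
Variables (a : nat -> nat -> R) (n : nat).
Notation r := (index_iota 1 n.+1).
Notation A := (array_norm a n).
Notation d := (array_max a n).

Lemma sqr_array_norm : A ^+ 2 = \sum_(k <- r) a k n ^+ 2.
Proof. by rewrite sqr_sqrtr// sumr_ge0// => k _; exact: sqr_ge0. Qed.

Lemma array_max_ge0 : 0 <= d.
Proof. exact: bigmax_ge_id. Qed.

Lemma le_array_max k : k \in r -> `|a k n| <= d.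
Proof.
by move=> kr; exact: (@le_bigmax_seq _ _ _ _ _ k xpredT (fun k => `|a k n|)).
Qed.

Lemma sqr_le_array_max k : k \in r -> a k n ^+ 2 <= d ^+ 2.
Proof.
move=> kr; rewrite -(real_normK (num_real (a k n))) lerXn2r ?nnegrE//.
  exact: array_max_ge0.
exact: le_array_max.
Qed.

Lemma array_max_le_norm : d <= A.
Proof.
rewrite /array_max big_seq.
apply: bigmax_le => [|k kr]; first exact: sqrtr_ge0.
rewrite -(@ler_pXn2r _ 2) ?nnegrE ?sqrtr_ge0// sqr_array_norm.
rewrite real_normK ?num_real// (bigD1_seq k) ?iota_uniq//= lerDl.
by apply: sumr_ge0 => l _; exact: sqr_ge0.
Qed.

Lemma sqr_array_norm_le : A ^+ 2 <= n%:R * d ^+ 2.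
Proof.
rewrite sqr_array_norm.
apply: (@le_trans _ _ (\sum_(k <- r) d ^+ 2)).
  by rewrite big_seq [leRHS]big_seq; apply: ler_sum => k; exact: sqr_le_array_max.
by rewrite big_const_seq count_predT iter_addr_0 size_iota subn1 -[leLHS]mulr_natl.
Qed.

Lemma pow4_array_norm_le : A ^+ 4 <= n%:R * \sum_(1 <= k < n.+1) a k n ^+ 4.
Proof.
rewrite -[4%N]/(2 * 2)%N exprM sqr_array_norm.
apply: le_trans (sqr_sum_le _ _) _; rewrite size_iota subn1 /=.
by rewrite ler_wpM2l//; apply: ler_sum => k _; rewrite -exprM.
Qed.

End arrays.

Section lacunary.
Context {R : realType}.
Variables (q : R) (m : nat -> nat).
Hypothesis q_gt1 : 1 < q.
Hypothesis m_pos : forall k, (1 <= k)%N -> (0 < m k)%N.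
Hypothesis m_inc : forall k, (1 <= k)%N -> (m k < m k.+1)%N.
Hypothesis m_ratio : forall k, (1 <= k)%N -> q <= (m k.+1)%:R / (m k)%:R.
Notation top k := (trunc_log 2 (m k)).

Lemma lacunary_mono k l : (1 <= k <= l)%N -> (m k <= m l)%N.
Proof.
move=> /andP[k1]; elim: l => [|l IH]; first by rewrite leqn0 => /eqP ->.
rewrite leq_eqVlt => /predU1P[->//|]; rewrite ltnS => kl.
by apply: leq_trans (IH kl) _; apply/ltnW/m_inc; exact: leq_trans kl.
Qed.

Lemma lacunary_gap k l : (1 <= k < l)%N -> q * (m k)%:R <= (m l)%:R.
Proof.
move=> /andP[k1 kl].
apply: (@le_trans _ _ (m k.+1)%:R).
  by rewrite -ler_pdivlMr ?ltr0n ?m_pos// m_ratio.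
by rewrite ler_nat lacunary_mono.
Qed.

Lemma lacunary_exponent : exists K, 1 <= (q - 1) * 2 ^+ K.
Proof.
have q1 : 0 < q - 1 by rewrite subr_gt0.
exists (Num.bound (q - 1)^-1).
rewrite mulrC -ler_pdivrMr// mul1r.
apply/ltW; apply: lt_le_trans (archi_boundP _) _.
  by rewrite invr_ge0 ltW.
by rewrite -natrX ler_nat ltnW// ltn_expl.
Qed.

(** Indices with leading digit 2^j are at least (q - 1) 2^j >= 2^(j - K) apart, so
the quotients by 2^(j - K) differ.  For j < K the quotient is by 1. *)
Lemma lacunary_digits K k l : 1 <= (q - 1) * 2 ^+ K -> (1 <= k)%N -> (1 <= l)%N ->
  k != l -> top k = top l ->
  (m k %/ 2 ^ (top k - K) != m l %/ 2 ^ (top k - K))%N.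
Proof.
move=> hK; wlog kl : k l / (k < l)%N.
  move=> H k1 l1 kl e; have [lt|ge] := ltnP k l; first exact: H.
  by rewrite eq_sym e H// 1?eq_sym// ltn_neqAle eq_sym kl.
move=> k1 l1 _ _; set j := top k.
have step : (m k + 2 ^ (j - K) <= m l)%N.
  have [jK|Kj] := leqP j K.
    have -> : (j - K = 0)%N by apply/eqP; rewrite subn_eq0.
    rewrite expn0 addn1; apply: leq_trans (m_inc k1) _.
    by rewrite lacunary_mono.
  have mj : 2 ^+ j <= (m k)%:R :> R.
    by rewrite -natrX ler_nat trunc_logP// m_pos.
  have jKj : 2 ^+ (j - K) * 2 ^+ K = 2 ^+ j :> R by rewrite -exprD subnK// ltnW.
  have p1 : 0 < 2 ^+ (j - K) :> R by rewrite exprn_gt0.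
  have gap : q * (m k)%:R <= (m l)%:R by apply: lacunary_gap; rewrite k1.
  rewrite -(ler_nat R) natrD natrX; apply: le_trans gap.
  have : 2 ^+ (j - K) <= (q - 1) * 2 ^+ j.
    by rewrite -jKj mulrCA -[leLHS]mulr1 ler_wpM2l// ltW.
  have : (q - 1) * 2 ^+ j <= (q - 1) * (m k)%:R by rewrite ler_wpM2l// subr_ge0 ltW.
  by lra.
rewrite neq_ltn; apply/orP; left.
apply: (@leq_trans ((m k + 2 ^ (j - K)) %/ 2 ^ (j - K))); last exact: leq_div2r.
by rewrite divnDr ?dvdnn// divnn expn_gt0/= addn1.
Qed.

(** Doubling an integer changes the position of its leading digit. *)
Lemma lacunary_top k l : 2 <= q -> (1 <= k)%N -> (1 <= l)%N -> k != l -> top k != top l.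
Proof.
move=> q2; wlog kl : k l / (k < l)%N.
  move=> H k1 l1 kl; have [lt|ge] := ltnP k l; first exact: H.
  by rewrite eq_sym H// 1?eq_sym// ltn_neqAle eq_sym kl.
move=> k1 l1 _; have gap : q * (m k)%:R <= (m l)%:R by apply: lacunary_gap; rewrite k1.
have gap2 : (2 * m k <= m l)%N.
  rewrite -(ler_nat R) natrM; apply: le_trans gap.
  by rewrite ler_wpM2r.
apply/eqP => e; have := trunc_log_ltn (m l) (isT : (1 < 2)%N).
rewrite -e ltnNge => /negP; apply; apply: leq_trans gap2.
by rewrite expnS leq_mul2l/= trunc_logP// m_pos.
Qed.

End lacunary.

Lemma cvg_seq_ubound (R : realType) (u : nat -> R) (l : R) :
  u n @[n --> \oo] --> l -> exists2 K, 1 <= K & forall n, u n <= K.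
Proof.
move=> ul; have /cvg_seq_bounded/pinfty_ex_gt0[K K0 uK] : cvgn u.
  by apply/cvg_ex; exists l.
exists (K + 1); first by lra.
move=> n; have := uK n I; have := ler_norm (u n) => ? /= ?; lra.
Qed.

(** * Kolmogorov distance of lacunary Walsh sums *)

Section walsh_kolmogorov.
Context {R : realType}.
Variables (q : R) (m : nat -> nat) (a : nat -> nat -> R).
Hypothesis q_gt1 : 1 < q.
Hypothesis m_pos : forall k, (1 <= k)%N -> (0 < m k)%N.
Hypothesis m_inc : forall k, (1 <= k)%N -> (m k < m k.+1)%N.
Hypothesis m_ratio : forall k, (1 <= k)%N -> q <= (m k.+1)%:R / (m k)%:R.

Notation kolmogorov n :=
  (kolmogorov_dist (normalized_walsh_sum a m n : {RV (lebesgue01 R) >-> R})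
     (normal_prob 0 1)).
Notation coef n := (fun k => a k n / array_norm a n).
Notation relmax n := (array_max a n / array_norm a n).

Lemma sum_sqr_coef n : 0 < array_norm a n ->
  \sum_(k <- index_iota 1 n.+1) (coef n k) ^+ 2 = 1.
Proof.
move=> A0; under eq_bigr do rewrite expr_div_n.
by rewrite -mulr_suml -sqr_array_norm divff// expf_neq0// gt_eqF.
Qed.

(** For delta > 1 the bound is trivial, as a Kolmogorov distance is at most 1. *)
Lemma kolmogorov_le_one_step n K (delta : R) : 0 < array_norm a n ->
  1 <= (q - 1) * 2 ^+ K -> 0 < delta ->
  (2 ^ K.+1)%:R * relmax n <= delta ->
  (kolmogorov n <= (@kolmogorov_const R *
     (delta + ((2 ^ K.+1)%:R * relmax n) ^+ 2 / delta ^+ 2 +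
      dmean (m n) (fun x => `|excess n m (coef n) (m n) x|) / delta ^+ 2))%:E)%E.
Proof.
move=> A0 hK d0 hd; set M := m n.
have in_r k : k \in index_iota 1 n.+1 -> (1 <= k <= n)%N by rewrite mem_index_iota.
have m_gt0 k : k \in index_iota 1 n.+1 -> (0 < m k)%N.
  by move=> /in_r/andP[k1 _]; exact: m_pos.
have m_lt k : k \in index_iota 1 n.+1 -> (m k < 2 ^ M)%N.
  move=> /in_r kn; apply: leq_ltn_trans (lacunary_mono m_inc kn) _.
  exact: ltn_expl.
have m_sep k l : k \in index_iota 1 n.+1 -> l \in index_iota 1 n.+1 -> k != l ->
    trunc_log 2 (m k) = trunc_log 2 (m l) ->
    (m k %/ 2 ^ (trunc_log 2 (m k) - K) != m l %/ 2 ^ (trunc_log 2 (m k) - K))%N.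
  move=> /in_r/andP[k1 _] /in_r/andP[l1 _].
  exact: (lacunary_digits q_gt1 m_pos m_inc m_ratio).
have c_le k : k \in index_iota 1 n.+1 -> `|coef n k| <= relmax n.
  move=> kr; rewrite normrM normfV (gtr0_norm A0) ler_wpM2r ?invr_ge0 ?(ltW A0)//.
  exact: le_array_max.
have rel_ge0 : 0 <= relmax n by rewrite divr_ge0 ?array_max_ge0 ?(ltW A0).
have kc1 : 1 <= @kolmogorov_const R.
  by have := @tail_const_ge2 R; rewrite /kolmogorov_const; lra.
apply: (kolmogorov_dist_walsh_le m_lt) => t.
have sumE x : normalized_walsh_sum a m n x = transform (block_coef n m (coef n)) M x.
  rewrite (transform_block _ m_gt0 m_lt) /normalized_walsh_sum /walsh_sum mulr_suml.
  by apply: eq_bigr => k _; rewrite mulrAC.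
under eq_dmean do rewrite sumE.
set D := dmean M (fun x => `|excess n m (coef n) M x|).
have D0 : 0 <= D / delta ^+ 2.
  by rewrite divr_ge0 ?sqr_ge0//; exact: dmean_ge0.
set B := _ ^+ 2 / delta ^+ 2.
have B0 : 0 <= B by rewrite divr_ge0 ?sqr_ge0.
have [d1|d1] := leP delta 1; last first.
  apply: (@le_trans _ _ 1); last first.
    by apply: (@le_trans _ _ (1 * (delta + B + D / delta ^+ 2)));
       [lra|rewrite ler_wpM2r//; lra].
  have := gauss_cdf_ge0 t; have := gauss_cdf_le1 t => p1 p0.
  have h0 : 0 <= dmean M (fun x => (transform (block_coef n m (coef n)) M x <= t)%R%:R).
    by apply: dmean_ge0.
  have h1 : dmean M (fun x => (transform (block_coef n m (coef n)) M x <= t)%R%:R) <= 1.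
    rewrite -[leRHS](dmean_cst M); apply: le_dmean => x.
    by rewrite -[leRHS]/(1%:R) ler_nat leq_b1.
  by rewrite ler_norml; apply/andP; split; lra.
have -> : D = dmean M (fun x => `|variance_left (block_coef n m (coef n)) M x|).
  apply: eq_dmean => x.
  by rewrite (variance_left_block m_gt0 m_lt) ?sum_sqr_coef// normrN.
apply: dyadic_martingale_kolmogorov => //.
  by move=> j; exact: adapted_block_coef.
by move=> j x; exact: (block_coef_le m_gt0 m_sep c_le).
Qed.

Lemma relmax_gt0 n : 0 < array_norm a n -> 0 < relmax n.
Proof.
move=> A0; rewrite divr_gt0// lt_neqAle array_max_ge0 andbT eq_sym.
apply/negP => /eqP d0; have := sqr_array_norm_le a n.
by rewrite d0 expr0n/= mulr0 leNgt exprn_gt0.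
Qed.

(** The choice delta = P e, with P the bound on the block sizes, ensures that the
coefficients P e^3 are at most delta and balances delta against the term
E |V - 1| / delta^2 = O(e^3 / delta^2). *)
Lemma kolmogorov_le_cube_root : exists2 C : R, 0 <= C &
  forall n e, 0 < array_norm a n -> 0 <= e -> e ^+ 3 = relmax n ->
    (kolmogorov n <= (C * e)%:E)%E.
Proof.
have [K hK] := lacunary_exponent q_gt1.
pose P : R := (2 ^ K.+1)%:R.
have P1 : 1 <= P by rewrite ler1n expn_gt0.
pose C1 := (2 * K%:R + 1) * P ^+ 3.
have C1_ge1 : 1 <= C1.
  have K0 : 0 <= K%:R :> R by [].
  have P3 : 1 <= P ^+ 3 by exact: exprn_ege1.
  by rewrite /C1; nra.
have kc1 : 1 <= @kolmogorov_const R.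
  by have := @tail_const_ge2 R; rewrite /kolmogorov_const; lra.
exists (@kolmogorov_const R * (P + 1 + C1)); first by rewrite mulr_ge0; lra.
move=> n e A0 e0 ed.
have rel0 := relmax_gt0 A0.
have e_gt0 : 0 < e.
  rewrite lt_neqAle e0 andbT; apply/eqP => e0'.
  by move: rel0; rewrite -ed -e0' expr0n ltxx.
have rel1 : relmax n <= 1 by rewrite ler_pdivrMr// mul1r array_max_le_norm.
have e1 : e <= 1 by rewrite -(@expr_le1 _ 3)// ed.
have Pe : 0 < P * e by rewrite mulr_gt0//; lra.
have e3 : e ^+ 3 <= e by rewrite -[leRHS]expr1 ler_wiXn2l// e0 e1.
have := @kolmogorov_le_one_step n K (P * e) A0 hK Pe.
rewrite -ed -/P ler_wpM2l ?(le_trans _ P1)// => /(_ isT) /le_trans; apply.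
rewrite lee_fin -mulrA ler_wpM2l ?(le_trans _ kc1)// !mulrDl mul1r.
have -> : (P * e ^+ 3) ^+ 2 / (P * e) ^+ 2 = e ^+ 4.
  by field; rewrite !gt_eqF//; lra.
have e4 : e ^+ 4 <= e by rewrite -[leRHS]expr1 ler_wiXn2l// e0 e1.
apply: lerD; first by rewrite lerD2l.
set D := dmean _ _.
have D_le : D <= C1 * e ^+ 3.
  have D0 : 0 <= D by exact: dmean_ge0.
  rewrite -(@ler_pXn2r _ 2) ?nnegrE// ?mulr_ge0 ?exprn_ge0//; try lra.
  apply: (le_trans (sqr_dmean_norm_le _ _)).
  have in_r k : k \in index_iota 1 n.+1 -> (1 <= k <= n)%N by rewrite mem_index_iota.
  apply: (@le_trans _ _ ((2 * K%:R + 1) * (2 ^ K.+1)%:R ^+ 3 * relmax n ^+ 2 *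
      \sum_(k <- index_iota 1 n.+1) (coef n k) ^+ 2)).
    apply: dmean_sqr_excess.
    - by move=> k /in_r/andP[k1 _]; exact: m_pos.
    - move=> k /in_r kn; apply: leq_ltn_trans (lacunary_mono m_inc kn) _.
      exact: ltn_expl.
    - move=> k l /in_r/andP[k1 _] /in_r/andP[l1 _].
      exact: (lacunary_digits q_gt1 m_pos m_inc m_ratio).
    - move=> k kr; rewrite normrM normfV (gtr0_norm A0).
      by rewrite ler_wpM2r ?invr_ge0 ?(ltW A0)//; exact: le_array_max.
    - exact: ltW.
  rewrite sum_sqr_coef// mulr1 -ed -/P -/C1;
  rewrite [leRHS]exprMn ler_wpM2r ?sqr_ge0//.
  by rewrite expr2 ler_peMl//; lra.
apply: (@le_trans _ _ (C1 * e ^+ 3 / (P * e) ^+ 2)).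
  by rewrite ler_wpM2r// invr_ge0 sqr_ge0.
have -> : C1 * e ^+ 3 / (P * e) ^+ 2 = C1 * e / P ^+ 2.
  by field; rewrite !gt_eqF//; lra.
by rewrite ler_pdivrMr ?exprn_gt0//; [rewrite ler_peMr ?exprn_ege1// mulr_ge0//; lra|lra].
Qed.

(** All blocks are singletons and the conditional variances are deterministic, so
delta of order e^2 balances delta against beta^2 / delta^2 with beta = 2 e^3. *)
Lemma kolmogorov_le_two_third : 2 <= q -> exists2 C : R, 0 <= C &
  forall n e, 0 < array_norm a n -> 0 <= e -> e ^+ 3 = relmax n ->
    (kolmogorov n <= (C * e ^+ 2)%:E)%E.
Proof.
move=> q2; have kc1 : 1 <= @kolmogorov_const R.
  by have := @tail_const_ge2 R; rewrite /kolmogorov_const; lra.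
(* with K = 0 the bound on the block sizes is 2, which is off by a harmless
   factor *)
have hK : 1 <= (q - 1) * 2 ^+ 0 by rewrite expr0 mulr1; lra.
exists (@kolmogorov_const R * 3); first by rewrite mulr_ge0//; lra.
move=> n e A0 e0 ed.
have rel0 := relmax_gt0 A0.
have e_gt0 : 0 < e.
  rewrite lt_neqAle e0 andbT; apply/eqP => e0'.
  by move: rel0; rewrite -ed -e0' expr0n ltxx.
have rel1 : relmax n <= 1 by rewrite ler_pdivrMr// mul1r array_max_le_norm.
have e1 : e <= 1 by rewrite -(@expr_le1 _ 3)// ed.
have d0 : 0 < 2 * e ^+ 2 by rewrite mulr_gt0// exprn_gt0.
have := @kolmogorov_le_one_step n 0 (2 * e ^+ 2) A0 hK d0.
rewrite -ed expn1 ler_wpM2l ?ler_wiXn2l ?e0// => /(_ isT) /le_trans; apply.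
rewrite lee_fin -mulrA ler_wpM2l ?(le_trans _ kc1)//.
have -> : dmean (m n) (fun x => `|excess n m (coef n) (m n) x|) = 0.
  rewrite -[RHS](dmean_cst (m n)); apply: eq_dmean => x.
  rewrite /excess big1 ?normr0// => j _.
  have in_r k : k \in index_iota 1 n.+1 -> (1 <= k <= n)%N by rewrite mem_index_iota.
  rewrite block_excessE big_seq big1// => k.
  rewrite mem_filter => /andP[/eqP kj /in_r/andP[k1 _]].
  rewrite big_seq_cond big1// => l.
  rewrite mem_filter => /andP[/andP[/eqP lj /in_r/andP[l1 _]] lk].
  by have := lacunary_top m_pos m_inc m_ratio q2 l1 k1 lk; rewrite kj lj eqxx.
have -> : (2 * e ^+ 3) ^+ 2 / (2 * e ^+ 2) ^+ 2 = e ^+ 2.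
  by field; rewrite gt_eqF.
by rewrite mul0r; lra.
Qed.

End walsh_kolmogorov.

(** * Exponents *)

Section exponents.
Context {R : realType}.
Implicit Types (x e g A d eps : R).

(** Allows bounds up to a constant to be checked after raising both sides to an
integer power that clears the denominators of the exponents. *)
Lemma le_of_pow_le x (K : R) k : 0 <= x -> 1 <= K -> x ^+ k.+1 <= K -> x <= K.
Proof.
move=> x0 K1 xK; have [x1|/ltW x1] := leP x 1; first exact: le_trans K1.
by apply: le_trans xK; rewrite exprS ler_peMr// exprn_ege1.
Qed.

Lemma powR_natmul x (p : R) k j : 0 <= x -> p * k%:R = j%:R -> (x `^ p) ^+ k = x ^+ j.
Proof.
by move=> x0 pk; rewrite -powR_mulrn ?powR_ge0// -powRrM pk powR_mulrn.
Qed.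

Lemma cube_root_powR x : 0 <= x -> (x `^ 3^-1) ^+ 3 = x.
Proof. by move=> x0; rewrite (@powR_natmul _ _ _ 1) ?expr1// mulVf. Qed.

(** The 15th power has integer exponents only and equals (d^5 A^4)^2. *)
Lemma exponent_ge2 A d e n (S K1 K2 : R) : 0 < A -> 0 <= d -> 0 <= e ->
  e ^+ 3 = d / A -> 1 <= K1 -> 1 <= K2 ->
  A ^+ 4 <= n%:R * S -> S <= K2 -> n%:R * d ^+ 5 <= K1 ->
  e ^+ 2 * A `^ (6 / 5) <= (K1 * K2) ^+ 2.
Proof.
move=> A0 d0 e0 ed K11 K21 AS SK dK.
have KK : 1 <= K1 * K2 by nra.
have An0 : A != 0 by rewrite gt_eqF.
apply: (@le_of_pow_le _ _ 14).
- by rewrite mulr_ge0 ?powR_ge0 ?sqr_ge0.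
- exact: exprn_ege1.
have -> : (e ^+ 2 * A `^ (6 / 5)) ^+ 15 = (d ^+ 5 * A ^+ 4) ^+ 2.
  rewrite exprMn (@powR_natmul _ _ _ 18) ?(ltW A0)//; last by field.
  have -> : (e ^+ 2) ^+ 15 = (e ^+ 3) ^+ 10 by ring.
  by rewrite ed; field.
have d5 : 0 <= d ^+ 5 by exact: exprn_ge0.
have A4 : 0 <= A ^+ 4 by rewrite exprn_ge0// ltW.
have h : d ^+ 5 * A ^+ 4 <= K1 * K2.
  apply: (@le_trans _ _ ((n%:R * d ^+ 5) * K2)).
    rewrite [leRHS](_ : _ = d ^+ 5 * (n%:R * K2)); last by ring.
    rewrite ler_wpM2l//.
    by apply: le_trans AS _; rewrite ler_wpM2l.
  by rewrite ler_wpM2r//; lra.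
by rewrite lerXn2r ?nnegrE// ?mulr_ge0//; lra.
Qed.

(** The cube of the left side is d A^(6 gamma + 2) <= n^(3 gamma + 1)
d^(6 gamma + 3), and 3 gamma + 1 <= (1 + eps) (1 + 2 gamma), so that it is at
most (n^(1 + eps) d^3)^(1 + 2 gamma). *)
Lemma exponent_lt2 A d e n (gamma eps K : R) : 0 < A -> 0 <= d -> 0 <= e ->
  e ^+ 3 = d / A -> 1 <= K -> 0 <= gamma -> 3 * gamma <= eps ->
  A ^+ 2 <= n%:R * d ^+ 2 -> n%:R `^ (1 + eps) * d ^+ 3 <= K ->
  e * A `^ (2 * gamma + 1) <= K `^ (1 + 2 * gamma).
Proof.
move=> A0 d0 e0 ed K1 g0 ge AS dK.
have A_ge0 := ltW A0; have An0 : A != 0 by rewrite gt_eqF.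
have n1 : 1 <= n%:R :> R.
  case: n AS {dK} => [|n _]; last by rewrite ler1n.
  by rewrite mul0r leNgt exprn_gt0.
apply: (@le_of_pow_le _ _ 2).
- by rewrite mulr_ge0 ?powR_ge0.
- by rewrite -[leLHS](powRr0 K) ler_powR//; lra.
have pow3 : (A `^ (2 * gamma + 1)) ^+ 3 = A * A `^ (6 * gamma + 2).
  rewrite -powR_mulrn ?powR_ge0// -powRrM -{2}(powRr1 A_ge0) -powRD; last first.
    by apply/implyP.
  by congr (_ `^ _); ring.
rewrite exprMn ed pow3 mulrA divfK//.
have A2 : A `^ (6 * gamma + 2) <= n%:R `^ (3 * gamma + 1) * d `^ (6 * gamma + 2).
  have -> : A `^ (6 * gamma + 2) = (A ^+ 2) `^ (3 * gamma + 1).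
    by rewrite -powR_mulrn// -powRrM; congr (_ `^ _); ring.
  have -> : d `^ (6 * gamma + 2) = (d ^+ 2) `^ (3 * gamma + 1).
    by rewrite -powR_mulrn// -powRrM; congr (_ `^ _); ring.
  rewrite -powRM ?sqr_ge0//.
  by apply: ge0_ler_powR; rewrite ?nnegrE ?sqr_ge0 ?mulr_ge0 ?sqr_ge0//; lra.
apply: (@le_trans _ _ ((n%:R `^ (1 + eps) * d ^+ 3) `^ (1 + 2 * gamma))); last first.
  apply: ge0_ler_powR; rewrite ?nnegrE ?mulr_ge0 ?powR_ge0 ?exprn_ge0//; lra.
rewrite powRM ?powR_ge0 ?exprn_ge0// -powRrM.
have -> : (d ^+ 3) `^ (1 + 2 * gamma) = d * d `^ (6 * gamma + 2).
  rewrite -powR_mulrn// -powRrM -{2}(powRr1 d0) -powRD.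
    by congr (_ `^ _); ring.
  by apply/implyP => /eqP; lra.
rewrite mulrCA ler_wpM2l//; apply: (le_trans A2).
by rewrite ler_wpM2r ?powR_ge0// ler_powR//; nra.
Qed.

End exponents.

Theorem theorem2p9 (R : realType) (q : R) (m : nat -> nat)
    (a : nat -> nat -> R) (kappa4 eps : R)
    (hq : 1 < q)
    (hm_pos : forall k, (1 <= k)%N -> (0 < m k)%N)
    (hm_inc : forall k, (1 <= k)%N -> (m k < m k.+1)%N)
    (hm_ratio : forall k, (1 <= k)%N -> q <= (m k.+1)%:R / (m k)%:R)
    (hA : array_norm a n @[n --> \oo] --> +oo)
    (hq_ge2 : 2 <= q ->
      ((\sum_(1 <= k < n.+1) a k n ^+ 4) @[n --> \oo] --> kappa4) /\
      ((n%:R * array_max a n ^+ 5) @[n --> \oo] --> (0 : R)))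
    (hq_lt2 : q < 2 ->
      0 < eps /\
      ((n%:R `^ (1 + eps) * array_max a n ^+ 3) @[n --> \oo] --> (0 : R))) :
  exists C : R, forall n : nat, 0 < array_norm a n ->
    (kolmogorov_dist
       (normalized_walsh_sum a m n : {RV (lebesgue01 R) >-> R})
       (normal_prob 0 1)
     <= (C / array_norm a n `^ (2 * rate_gamma q eps + 1))%:E)%E.
Proof.
have [q2|q2] := leP 2 q.
  have [/cvg_seq_ubound[K2 K21 hK2] /cvg_seq_ubound[K1 K11 hK1]] := hq_ge2 q2.
  have [C C0 hC] := kolmogorov_le_two_third a hq hm_pos hm_inc hm_ratio q2.
  exists (C * (K1 * K2) ^+ 2) => n A0.
  have rel0 := ltW (relmax_gt0 A0).
  have ed := cube_root_powR rel0.
  apply: (le_trans (hC n _ A0 (powR_ge0 _ _) ed)).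
  have -> : 2 * rate_gamma q eps + 1 = 6 / 5 by rewrite /rate_gamma q2; field.
  rewrite lee_fin ler_pdivlMr ?powR_gt0// -mulrA ler_wpM2l//.
  exact: (exponent_ge2 A0 (array_max_ge0 a n) (powR_ge0 _ _) ed K11 K21
    (pow4_array_norm_le a n) (hK2 n) (hK1 n)).
have [eps0 /cvg_seq_ubound[K K1 hK]] := hq_lt2 q2.
have [C C0 hC] := kolmogorov_le_cube_root a hq hm_pos hm_inc hm_ratio.
set gamma := rate_gamma q eps.
have gammaE : gamma = Num.min (eps / 3) 3^-1.
  by rewrite /gamma /rate_gamma leNgt q2.
have gamma0 : 0 <= gamma by rewrite gammaE le_min divr_ge0 ?(ltW eps0)//= invr_ge0.
have gamma_eps : 3 * gamma <= eps.
  have : gamma <= eps / 3 by rewrite gammaE ge_min lexx.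
  by lra.
exists (C * K `^ (1 + 2 * gamma)) => n A0.
have rel0 := ltW (relmax_gt0 A0).
have ed := cube_root_powR rel0.
apply: (le_trans (hC n _ A0 (powR_ge0 _ _) ed)).
rewrite lee_fin ler_pdivlMr ?powR_gt0// -mulrA ler_wpM2l//.
exact: (exponent_lt2 A0 (array_max_ge0 a n) (powR_ge0 _ _) ed K1 gamma0
  gamma_eps (sqr_array_norm_le a n) (hK n)).
Qed.
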